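(* Let $(\mathcal{G}_\rho)_{\rho_{\min}\le\rho\le\rho_{\max}}$ be a collection of classes of subsets of $\mathcal{X}=\mathbb{R}^d$ satisfying Assumption (A1) (defined in the context). Then the aggregate $\tilde f_n=\sum_{j=0}^{N(m)}w_j^{(l)}\hat f_m^j$ (defined in the context) satisfies $$\sup_{\pi\in\mathcal{P}_{\kappa,\rho}}\mathbb{E}[R(\tilde f_n)-R^*]\le C\,n^{-\kappa/(2\kappa+\rho-1)}\qquad\forall n\ge1,$$ for all $1\le\kappa<+\infty$ and all $\rho\in[\rho_{\min},\rho_{\max}]$, where $C>0$ is a constant depending only on $a,b,b',A,A_0,A_0',\rho_{\min},\rho_{\max}$ and $\kappa$, and $\mathcal{P}_{\kappa,\rho}$ is the set of all probability measures $\pi$ on $\mathcal{X}\times\{-1,1\}$ such that the margin assumption (MA1)$(\kappa)$ is satisfied and $G^*=\{x\in\mathcal{X}:\eta(x)>1/2\}\in\mathcal{G}_\rho$.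
   Context: Setting: $\pi$ is a probability distribution on $\mathcal{X}\times\{-1,1\}$ with marginal $P^X$ on $\mathcal{X}=\mathbb{R}^d$; $D_n=((X_i,Y_i))_{i=1}^n$ is an i.i.d. sample from $\pi$ and $(X,Y)\sim\pi$ is independent of $D_n$. $\eta(x)=\mathbb{P}(Y=1|X=x)$, $f^*(x)=\mathrm{sign}(2\eta(x)-1)$ with $\mathrm{sign}(0)=1$, $R(f)=\mathbb{P}(Y\ne f(X))$ for $\{-1,1\}$-valued $f$, $R^*=R(f^* )$; for a real-valued, possibly data-dependent, $f$, $R(f)=\mathbb{P}(Y\ne\mathrm{sign}(f(X))\mid D_n)$. Margin assumption (MA1)$(\kappa)$: there exists $c>0$ such that $\mathbb{E}\{|f(X)-f^*(X)|\}\le c\,(R(f)-R^* )^{1/\kappa}$ for all measurable $f:\mathcal{X}\to\{-1,1\}$. Pseudo-distance between sets and its empirical analogue: $d_\Delta(G,G')=P^X(G\Delta G')$ and $d_{\Delta,e}(G,G')=\frac1n\sum_{i=1}^n\mathbb{1}_{(X_i\in G\Delta G')}$, where $G\Delta G'$ is the symmetric difference. For a class $\mathcal{Y}$ of subsets of $\mathcal{X}$, $\mathcal{H}_B(\mathcal{Y},\delta,d_\Delta)$ is its $\delta$-entropy with bracketing for $d_\Delta$: the logarithm of the smallest $N$ for which there are pairs $(L_i,U_i)$, $i=1,\dots,N$, with $d_\Delta(L_i,U_i)\le\delta$, such that each $G\in\mathcal{Y}$ satisfies $L_i\subseteq G\subseteq U_i$ for some $i$. $\mathcal{Y}$ has complexity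 bound $\rho>0$ if there exists a constant $A>0$ such that $\mathcal{H}_B(\mathcal{Y},\delta,d_\Delta)\le A\delta^{-\rho}$ for all $0<\delta\le1$. Assumption (A1): $0<\rho_{\min}<\rho_{\max}<1$, the $\mathcal{G}_\rho$'s are classes of subsets of $\mathcal{X}$ such that $\mathcal{G}_\rho\subseteq\mathcal{G}_{\rho'}$ for $\rho_{\min}\le\rho<\rho'\le\rho_{\max}$, and $\mathcal{G}_\rho$ has complexity bound $\rho$. For any integer $n$ put $\rho_{n,j}=\rho_{\min}+\frac{j}{N(n)}(\rho_{\max}-\rho_{\min})$, $j=0,\dots,N(n)$, where $N(n)$ satisfies $A_0'n^{b'}\le N(n)\le A_0n^b$ for some finite $b\ge b'>0$ and $A_0,A_0'>0$. For all $n\in\mathbb{N}$: (i) for all $j=0,\dots,N(n)$ there exists an $\varepsilon$-net $\mathcal{N}_n^j$ on $\mathcal{G}_{\rho_{n,j}}$ for the pseudo-distance $d_\Delta$ or $d_{\Delta,e}$, where $\varepsilon=a_jn^{-1/(1+\rho_{n,j})}$, $a_j>0$ and $\max_ja_j<+\infty$; (ii) $\mathcal{N}_n^j$ has complexity bound $\rho_{n,j}$ for $j=0,\dots,N(n)$. Procedure: for a constant $a>0$ let $l=\lceil an/\log n\rceil$, $m=n-l$, $D_m^1=((X_i,Y_i))_{i=1}^m$, $D_l^2=((X_i,Y_i))_{i=m+1}^n$. With $R_m(f)=\frac1m\sum_{i=1}^m\mathbb{1}_{(Y_if(X_i)\le0)}$, let $\hat G_m^j\in\mathrm{Arg\,min}_{G\in\mathcal{N}_m^j}R_m(2\mathbb{1}_G-1)$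 and $\hat f_m^j=2\mathbb{1}_{\hat G_m^j}-1$ for $j=0,\dots,N(m)$. With $A^{[l]}(f)=\frac1l\sum_{i=m+1}^n(1-Y_if(X_i))_+$, $z_+=\max(0,z)$, let $$w_j^{(l)}=\frac{\exp(-lA^{[l]}(\hat f_m^j))}{\sum_{k=0}^{N(m)}\exp(-lA^{[l]}(\hat f_m^k))},\quad j=0,\dots,N(m).$$
   Formalization: C may also depend on the constant c of (MA1)(κ) and on a uniform bound for the a_j (the claim fails uniformly in them); for sample-dependent nets the complexity bound is required of all sets the net may contain together; measurability of the sets and of the minimizers is assumed. *)

(* Defs.v *)
From HB Require Import structures.
From mathcomp Require Import all_boot all_order all_algebra.
From mathcomp Require Import all_classical all_reals all_analysis.

Set Implicit Arguments.
Unset Strict Implicit.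
Unset Printing Implicit Defensive.

Import Order.TTheory GRing.Theory Num.Theory.
Import numFieldNormedType.Exports.

Local Open Scope classical_set_scope.
Local Open Scope ring_scope.

(* R^d with the product (= Borel) sigma-algebra. *)
Notation Rspace R d := (d.-tuple (measurableTypeR R))%type.

(* A labelled observation (x, y); [true] stands for the label 1 and [false]
   for the label -1, see [lab]. *)
Notation obs R d := (Rspace R d * bool)%type.

Definition lab (R : realType) (y : bool) : R := if y then 1 else -1.

(* sign(0) = 1, unlike [Num.sg]. *)
Definition sign1 (R : realType) (t : R) : R := if 0 <= t then 1 else -1.

(* The classifier 2 1_G - 1. *)
Definition set_classifier (R : realType) (T : Type) (G : set T) (x : T) : R :=
  2 * \1_G x - 1.

Section Distribution.
Context {R : realType} {d : nat}.
Implicit Types (pi : probability (obs R d) R) (f eta : Rspace R d -> R).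

Definition risk pi f : R :=
  fine (pi [set z | lab R z.2 != sign1 (f z.1)]).

Definition marginal pi : set (Rspace R d) -> \bar R := pushforward pi fst.

(* [eta] is a version of x |-> P(Y = 1 | X = x):
   P(X \in B, Y = 1) = E[eta(X) 1_B(X)] for every Borel set B. *)
Definition regression_function pi eta : Prop :=
  [/\ measurable_fun setT eta,
      forall x, 0 <= eta x <= 1 &
      forall B, measurable B ->
        pi (B `*` [set true]) = (\int[pi]_(z in fst @^-1` B) (eta z.1)%:E)%E].

Definition bayes eta (x : Rspace R d) : R := sign1 (2 * eta x - 1).

Definition excess_risk pi eta f : R := risk pi f - risk pi (bayes eta).

(* [kappa] is the margin parameter and [c] the constant in front. *)
Definition margin_assumption (kappa c : R) pi eta : Prop :=
  forall f, measurable_fun setT f -> (forall x, f x = 1 \/ f x = -1) ->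
    ('E_pi[fun z => (`|f z.1 - bayes eta z.1|)%R]
       <= (c * (excess_risk pi eta f) `^ (kappa^-1))%:E)%E.

Definition bayes_set eta : set (Rspace R d) := [set x | 2^-1 < eta x].

(* [pi] belongs to P_{kappa,rho}, where [calG] is the class G_rho and [eta] is
   the version of the regression function defining f^* and G^*. *)
Definition margin_class (kappa c : R) (calG : set (set (Rspace R d))) pi eta
    : Prop :=
  [/\ regression_function pi eta,
      margin_assumption kappa c pi eta &
      calG (bayes_set eta)].

End Distribution.

Section Entropy.
Context {R : realType} {d : nat}.
Local Notation X := (Rspace R d).
Implicit Types (PX : set X -> \bar R) (calY net : set (set X)).

Definition d_Delta PX (G G' : set X) : \bar R := PX (G `+` G').

Definition d_Delta_e (n : nat) (D : n.-tuple (obs R d)) (G G' : set X)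
    : \bar R :=
  (n%:R^-1 * \sum_(i < n) \1_(G `+` G') (tnth D i).1)%:E.

Definition bracketing_cover PX calY (delta : R) (N : nat) : Prop :=
  exists L U : 'I_N -> set X,
    (forall i, [/\ measurable (L i), measurable (U i) &
                   (d_Delta PX (L i) (U i) <= delta%:E)%E]) /\
    (forall G, calY G -> exists i, L i `<=` G /\ G `<=` U i).

(* +oo when there is no finite cover. *)
Definition bracketing_number PX calY (delta : R) : \bar R :=
  ereal_inf [set (N%:R)%:E | N in bracketing_cover PX calY delta].

Definition bracketing_entropy PX calY (delta : R) : \bar R :=
  lne (bracketing_number PX calY delta).

(* Complexity bound [rho] with constant [A]. *)
Definition complexity_bound PX (A rho : R) calY : Prop :=
  forall delta, 0 < delta <= 1 ->
    (bracketing_entropy PX calY delta <= (A * delta `^ (- rho))%:E)%E.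

(* The net need not be contained in [calG]. *)
Definition eps_net (dist : set X -> set X -> \bar R) (eps : R) calG net
    : Prop :=
  forall G, calG G -> exists2 G', net G' & (dist G G' <= eps%:E)%E.

(* rho_{n,j} *)
Definition rho_grid (rmin rmax : R) (N : nat -> nat) (n j : nat) : R :=
  rmin + j%:R / (N n)%:R * (rmax - rmin).

(* A net for d_{Delta,e} lives on the design points, so [net n j] is a function
   of the sample of size n (a constant one for a nonrandom net).  For such a
   random net the complexity bound is required of the collection of all the
   sets which it may contain; for a nonrandom net this is the net itself. *)
Record assumption_A1 PX (A A0 A0' b b' rmin rmax abar : R)
    (calG : R -> set (set X)) (N : nat -> nat) (a_ : nat -> nat -> R)
    (net : forall n, nat -> n.-tuple (obs R d) -> set (set X)) : Prop := {
  A1_measurable : forall rho G, rmin <= rho <= rmax -> calG rho G ->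
    measurable G;
  A1_nested : forall rho rho', rmin <= rho -> rho < rho' -> rho' <= rmax ->
    calG rho `<=` calG rho';
  A1_complexity : forall rho, rmin <= rho <= rmax ->
    complexity_bound PX A rho (calG rho);
  A1_grid : forall n, (0 < n)%N ->
    A0' * n%:R `^ b' <= (N n)%:R <= A0 * n%:R `^ b;
  A1_radius : forall n j, (0 < n)%N -> (j <= N n)%N -> 0 < a_ n j <= abar;
  A1_net_measurable : forall n j (D : n.-tuple (obs R d)) G,
    (0 < n)%N -> (j <= N n)%N -> net n j D G -> measurable G;
  A1_net : forall n j, (0 < n)%N -> (j <= N n)%N ->
    let rho := rho_grid rmin rmax N n j in
    let eps := a_ n j * n%:R `^ (- (1 + rho)^-1) in
    (forall D, eps_net (d_Delta PX) eps (calG rho) (net n j D)) \/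
    (forall D, eps_net (d_Delta_e D) eps (calG rho) (net n j D));
  A1_net_complexity : forall n j, (0 < n)%N -> (j <= N n)%N ->
    complexity_bound PX A (rho_grid rmin rmax N n j)
      (\bigcup_(D in [set: n.-tuple (obs R d)]) net n j D)
}.

End Entropy.

Section Procedure.
Context {R : realType} {d : nat}.
Local Notation X := (Rspace R d).

(* Total conventions: [ln 1 = 0] and [x / 0 = 0] give l = 0 when n = 1, and
   m = 0 when l > n; this concerns finitely many n for given a. *)
Definition size_l (a : R) (n : nat) : nat :=
  `|Num.ceil (a * n%:R / ln (n%:R : R))|%N.

Definition size_m (a : R) (n : nat) : nat := (n - size_l a n)%N.

Definition emp_risk (m : nat) (D : m.-tuple (obs R d)) (f : X -> R) : R :=
  m%:R^-1 * \sum_(i < m)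
    (if lab R (tnth D i).2 * f (tnth D i).1 <= 0 then 1 else 0).

(* [Ghat m j] is a measurable rule selecting a minimizer of the empirical risk
   over the j-th net at sample size m. *)
Definition emp_risk_minimizers (N : nat -> nat)
    (net : forall m, nat -> m.-tuple (obs R d) -> set (set X))
    (Ghat : forall m, nat -> m.-tuple (obs R d) -> set X) : Prop :=
  (forall m j, measurable [set p : m.-tuple (obs R d) * X | Ghat m j p.1 p.2])
  /\
  (forall m j D, (0 < m)%N -> (j <= N m)%N ->
    net m j D (Ghat m j D) /\
    forall G, net m j D G ->
      emp_risk D (set_classifier R (Ghat m j D))
        <= emp_risk D (set_classifier R G)).

Section Aggregate.
Variables (a : R) (N : nat -> nat).
Variable Ghat : forall m, nat -> m.-tuple (obs R d) -> set X.
Variables (n : nat) (z : nat -> obs R d).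

Let l := size_l a n.
Let m := size_m a n.

(* Observations are numbered from 0, so D_m^1 is made of z 0, ..., z (m - 1)
   and D_l^2 of z m, ..., z (n - 1). *)
Definition fhat (j : nat) : X -> R :=
  set_classifier R (Ghat j [tuple z i | i < m]).

Definition hinge_risk (f : X -> R) : R :=
  l%:R^-1 * \sum_(m <= i < n) Num.max 0 (1 - lab R (z i).2 * f (z i).1).

Definition weight (j : nat) : R :=
  expR (- (l%:R * hinge_risk (fhat j))) /
  \sum_(k < (N m).+1) expR (- (l%:R * hinge_risk (fhat k))).

Definition aggregate (x : X) : R :=
  \sum_(j < (N m).+1) weight j * fhat j x.

End Aggregate.

(* Z 0, ..., Z (n - 1) are i.i.d. with law [pi] (take B i = setT for all but
   some of the indices to recover the marginals and subfamilies); the remaining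
   terms of the sequence are irrelevant. *)
Definition iid_sample (dO : measure_display) (Omega : measurableType dO)
    (P : probability Omega R) (pi : probability (obs R d) R)
    (Z : nat -> {RV P >-> obs R d}) (n : nat) : Prop :=
  forall B : 'I_n -> set (obs R d), (forall i, measurable (B i)) ->
    P (\bigcap_(i in [set: 'I_n]) (Z i @^-1` B i)) = (\prod_(i < n) pi (B i))%E.

End Procedure.

(* Main.v *)
Require Import Defs.
From mathcomp Require Import all_boot all_order all_algebra.
From mathcomp Require Import all_classical all_reals all_analysis.
From mathcomp Require Import measurable_realfun.
From mathcomp Require Import zify ring lra.

Set Implicit Arguments.
Unset Strict Implicit.
Unset Printing Implicit Defensive.

Import Order.TTheory GRing.Theory Num.Theory.
Import numFieldNormedType.Exports.

Local Open Scope classical_set_scope.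
Local Open Scope ring_scope.

(* Write G* for the Bayes set, e(G) for the excess risk of the classifier of G
   and d(G) for the probability of the symmetric difference of G and G*; the
   margin assumption gives d(G)^kappa <= (c/2)^kappa e(G).  The target rate is
   delta^kappa with delta = n^(-1/(2 kappa + rho - 1)).

   All stochastic bounds come from one exponential inequality,
   E exp(lam (S - E S) - 2 lam^2 Var) <= 1 for a sum S of terms bounded by 1,
   and a union bound: finitely many variables xi_i with E exp(xi_i) <= 1 are
   all at most log(number) + Y for a single Y >= 0 of mean at most 1.

   Empirical risk minimization.  Brackets at the scales delta / 2^k are chained,
   the exponent at scale k being chosen so that entropy and variance agree;
   the chain stops as soon as the exponent reaches 1, at a scale of order
   delta^kappa, where the bias is already of the order of the rate.  Up to a
   multiple of delta^kappa, the empirical excess risk of every net element then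
   differs from its excess risk by a small multiple of delta^(kappa-1) d(G),
   which Young's inequality and the margin assumption absorb into e(G).  This is
   used for the smallest grid point above rho, which costs only a constant since
   n^(1/N(n)) is bounded.

   Aggregation.  The excess risk of the vote is at most twice the weighted mean of
   the excess risks.  Given the first subsample, the same deviation bound compares
   this mean with the weighted mean of the empirical excess risks on the second
   one, which by Gibbs' inequality exceeds the empirical excess risk of any fixed
   candidate by at most log(N + 1) / (2 l). *)

(** * Independence and exponential deviation bounds *)

Section mean_le.
Context d (T : measurableType d) (R : realType) (P : probability T R).
Implicit Types (X Y : T -> R) (x y c : R).

(** The form in which every random error enters. Nonnegativity makes such bounds additive without
    any integrability to check. *)
Definition mean_le Y c : Prop :=
  [/\ measurable_fun setT Y, forall w, 0 <= Y w &
      (\int[P]_w (Y w)%:E <= c%:E)%E].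

Lemma mean_leS Y x y : mean_le Y x -> x <= y -> mean_le Y y.
Proof.
by case=> mY Y0 YE xy; split => //; rewrite (le_trans YE)// lee_fin.
Qed.

Lemma mean_leD X Y x y : mean_le X x -> mean_le Y y ->
  mean_le (fun w => X w + Y w) (x + y).
Proof.
move=> [mX X0 XE] [mY Y0 YE]; split.
- exact: measurable_funD.
- by move=> w; rewrite addr_ge0.
- under eq_integral do rewrite EFinD.
  rewrite ge0_integralD//.
  + by rewrite EFinD leeD.
  + by move=> w _; rewrite lee_fin.
  + exact/measurable_EFinP.
  + by move=> w _; rewrite lee_fin.
  + exact/measurable_EFinP.
Qed.

Lemma mean_leZ Y c y : 0 <= c -> mean_le Y y ->
  mean_le (fun w => c * Y w) (c * y).
Proof.
move=> c0 [mY Y0 YE]; split.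
- exact: measurable_funM.
- by move=> w; rewrite mulr_ge0.
- under eq_integral do rewrite EFinM.
  rewrite ge0_integralZl_EFin//.
  + by rewrite EFinM lee_wpmul2l// lee_fin.
  + by move=> w _; rewrite lee_fin.
  + exact/measurable_EFinP.
Qed.

Lemma mean_le_cst c : 0 <= c -> mean_le (cst c) c.
Proof.
move=> c0; split => //.
rewrite (_ : (fun w => _) = cst c%:E)// integral_cst//= probability_setT.
by rewrite mule1.
Qed.

Lemma mean_le_sum n (Y : 'I_n -> T -> R) (y : 'I_n -> R) :
  (forall i, mean_le (Y i) (y i)) ->
  mean_le (fun w => \sum_(i < n) Y i w) (\sum_(i < n) y i).
Proof.
elim: n Y y => [|n ih] Y y Yy.
  under eq_fun do rewrite big_ord0.
  by rewrite big_ord0; exact: mean_le_cst.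
under eq_fun do rewrite big_ord_recr.
by rewrite big_ord_recr; apply: mean_leD => //; exact: ih.
Qed.

(* The integral of a nonnegative function is a supremum over smaller simple
   functions, so [X] need not be measurable. *)
Lemma expectation_le_mean X Y c : mean_le Y c -> (forall w, 0 <= X w) ->
  (forall w, X w <= Y w) -> ('E_P[X] <= c%:E)%E.
Proof.
move=> [mY Y0 YE] X0 XY; rewrite unlock; apply: le_trans YE.
rewrite !ge0_integralTE//.
apply: le_ereal_sup => _ [h hX <-]; exists h => // w.
by rewrite (le_trans (hX w))// lee_fin.
Qed.

Lemma bounded_integrable X c : measurable_fun setT X ->
  (forall w, `|X w| <= c) -> P.-integrable setT (EFin \o X).
Proof.
move=> mX Xc; apply: measurable_bounded_integrable => //.
  by apply: (le_lt_trans (probability_le1 P measurableT)); rewrite ltry.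
exists c; split; first exact: num_real.
by move=> x cx w _; exact: le_trans (Xc w) (ltW cx).
Qed.

End mean_le.

(** * Independence of an observation from the preceding ones *)

Section independent_sample.
Context dO (Omega : measurableType dO) (R : realType) (P : probability Omega R)
  d (T : measurableType d) (mu : probability T R) (Z : nat -> {RV P >-> T})
  (n : nat).
Hypothesis iidZ : forall B : 'I_n -> set T, (forall i, measurable (B i)) ->
  P (\bigcap_(i in [set: 'I_n]) (Z i @^-1` B i)) = (\prod_(i < n) mu (B i))%E.

Definition prefix (k : nat) (w : Omega) : k.-tuple T := [tuple Z i w | i < k].

Lemma measurable_prefix k : measurable_fun setT (prefix k).
Proof.
apply/measurable_fun_tnthP => i.
rewrite (_ : _ \o _ = Z i); first exact: measurable_funPT.
by apply/funext => w /=; rewrite tnth_mktuple.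
Qed.

Definition prefix_mfun k : {mfun Omega >-> k.-tuple T} :=
  mfun_Sub (mem_set (@measurable_prefix k)).

(** A pi-system generating the product sigma-algebra, on which finite measures can be compared. *)
Definition cylinders k : set (set (k.-tuple T)) :=
  [set C | exists2 A : 'I_k -> set T, (forall i, measurable (A i)) &
     C = [set t | forall i, A i (tnth t i)]].

Lemma cylinders_setI k : setI_closed (@cylinders k).
Proof.
move=> _ _ [A mA ->] [B mB ->]; exists (fun i => A i `&` B i).
  by move=> i; exact: measurableI.
by apply/seteqP; split => [t [tA tB] i|t tAB] //=; split=> i; case: (tAB i).
Qed.

Lemma measurable_cylinder k (A : 'I_k -> set T) :
  (forall i, measurable (A i)) ->
  measurable [set t : k.-tuple T | forall i, A i (tnth t i)].
Proof.
move=> mA.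
rewrite (_ : [set _ | _] =
  \bigcap_(i in [set: 'I_k]) ((@tnth k T ^~ i) @^-1` A i)); last first.
  by apply/seteqP; split => t /= h i; [move=> _|]; exact: h.
apply: fin_bigcap_measurable => // i _.
by rewrite -[X in measurable X]setTI; exact: measurable_tnth.
Qed.

Lemma cylinders_generate k :
  (@measurable _ (k.-tuple T)) = <<s @cylinders k >>.
Proof.
apply/seteqP; split; last first.
  apply: smallest_sub; first exact: sigma_algebra_measurable.
  by move=> _ [A mA ->]; exact: measurable_cylinder.
apply: smallest_sub; first exact: smallest_sigma_algebra.
apply: subset_trans; last exact: sub_sigma_algebra.
case: k => [|k]; first by rewrite big_ord0.
rewrite -bigcup_mkord_ord => B [i /= ik [A mA]]; rewrite setTI => <-.
exists (fun j => if j == inord i then A else setT).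
  by move=> j; case: ifP.
apply/seteqP; split => t /= h.
  by move=> j; case: eqP => // ->.
by have := h (inord i); rewrite eqxx.
Qed.

Lemma prefix_cylinder k (A : 'I_k -> set T) (B : set T) : (k < n)%N ->
  (forall i, measurable (A i)) -> measurable B ->
  P (prefix k @^-1` [set t | forall i, A i (tnth t i)] `&` Z k @^-1` B) =
  ((\prod_(i < k) mu (A i)) * mu B)%E.
Proof.
move=> kn mA mB.
(* The i.i.d. hypothesis speaks of all [n] observations at once; those of index above [k] are left
   free by [setT]. *)
pose C (i : nat) := if insub i is Some j then A j
  else if i == k then B else setT.
have mC i : measurable (C i).
  by rewrite /C; case: insubP => // _; case: ifP.
have Ck : C k = B by rewrite /C insubF ?ltnn// eqxx.
have Clt (i : 'I_k) : C i = A i by rewrite /C valK.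
have Cgt i : (k < i)%N -> C i = setT.
  by move=> ki; rewrite /C insubF ?(gtn_eqF ki)// ltnNge ltnW.
have := iidZ (fun i => mC (val i)).
rewrite -(big_mkord xpredT (fun i => mu (C i))) (big_cat_nat (n := k.+1))//=.
rewrite big_nat_recr//= [X in (_ * _ * X)%E]big_nat_cond.
rewrite [X in (_ * _ * X)%E]big1 => [|i /andP[/andP[ki _] _]]; last first.
  by rewrite Cgt// probability_setT.
rewrite mule1 Ck big_mkord.
rewrite (eq_bigr (fun i => mu (A i))); last by move=> i _; rewrite -Clt.
move=> <-; congr (P _); apply/seteqP; split.
  move=> w [/= wA wB] i _; have [ik|ki|ik] := ltngtP i k.
  - by have := wA (Ordinal ik); rewrite tnth_mktuple -Clt.
  - by rewrite /= Cgt.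
  - by rewrite /= ik Ck.
move=> w wC; split => /= [i|].
  rewrite tnth_mktuple -Clt.
  exact: (wC (widen_ord (ltnW kn) i)).
by rewrite -Ck; exact: (wC (Ordinal kn)).
Qed.

(** For fixed [B] both sides are finite measures in [S], and they agree on cylinders. *)
Lemma prefix_indep k (S : set (k.-tuple T)) (B : set T) : (k < n)%N ->
  measurable S -> measurable B ->
  P (prefix k @^-1` S `&` Z k @^-1` B) = (P (prefix k @^-1` S) * mu B)%E.
Proof.
move=> kn mS mB.
have mZB : measurable (Z k @^-1` B).
  by rewrite -[X in measurable X]setTI; exact: measurable_funPT.
have muB0 : 0 <= fine (mu B) by rewrite fine_ge0.
have muBE : (fine (mu B))%:E = mu B by rewrite fineK// fin_num_measure.
pose m1 := pushforward (mrestr P mZB) (prefix_mfun k).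
pose m2 := mscale (NngNum muB0) (distribution P (prefix_mfun k)).
have m2E S' : (m2 S' = P (prefix k @^-1` S') * mu B)%E.
  by rewrite muleC -muBE.
rewrite -m2E.
have -> : P (prefix k @^-1` S `&` Z k @^-1` B) = m1 S by [].
apply: (measure_unique (@cylinders k) (fun=> setT)) => //.
- exact: cylinders_generate.
- exact: cylinders_setI.
- by move=> _; exists (fun=> setT) => //; apply/seteqP; split.
- by rewrite bigcup_const.
- move=> _ [A mA ->].
  transitivity ((\prod_(i < k) mu (A i)) * mu B)%E.
    exact: prefix_cylinder.
  apply/esym; apply: (etrans (m2E _)); congr (_ * _)%E.
  have := prefix_cylinder kn mA measurableT.
  by rewrite preimage_setT setIT probability_setT mule1 => <-.
- move=> _; rewrite /m1 /pushforward /mrestr.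
  apply: le_lt_trans (ltry 1); apply: probability_le1.
  by rewrite preimage_setT setTI.
Qed.

End independent_sample.

Section independent_product.
Context dO (Omega : measurableType dO) (R : realType) (P : probability Omega R)
  d (T : measurableType d) (mu : probability T R) (Z : nat -> {RV P >-> T})
  (n : nat).
Hypothesis iidZ : forall B : 'I_n -> set T, (forall i, measurable (B i)) ->
  P (\bigcap_(i in [set: 'I_n]) (Z i @^-1` B i)) = (\prod_(i < n) mu (B i))%E.
Local Open Scope ereal_scope.
Local Notation prefix := (prefix Z).

(** By independence the prefix and the next observation have a product law, so Tonelli's theorem
    integrates out the latter with the past held fixed. *)
Lemma integral_prefix k (f : k.-tuple T * T -> \bar R) : (k < n)%N ->
  measurable_fun setT f -> (forall z, 0 <= f z) ->
  \int[P]_w f (prefix k w, Z k w) = \int[P]_w \int[mu]_z f (prefix k w, z).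
Proof.
move=> kn mf f0.
have mJ : measurable_fun setT (fun w => (prefix k w, Z k w)).
  by apply/measurable_fun_pair => //; exact: measurable_prefix.
pose J : {mfun Omega >-> (k.-tuple T * T)%type} := mfun_Sub (mem_set mJ).
pose D := distribution P (prefix_mfun Z k).
have DE S : measurable S -> (D \x mu) S = distribution P J S.
  apply: product_measure_unique => A B mA mB.
  rewrite /D /distribution /pushforward /= -(prefix_indep iidZ)//.
transitivity (\int[distribution P J]_z f z).
  by rewrite ge0_integral_pushforward// => z _; exact: f0.
transitivity (\int[D \x mu]_z f z).
  by apply: eq_measure_integral => S mS _; apply/esym/DE.
rewrite fubini_tonelli1//.
rewrite ge0_integral_pushforward//.
  exact: measurable_fun_fubini_tonelli_F.
by move=> t _; exact: integral_ge0.
Qed.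

(** Induction on [q]: the last observation is integrated out and its factor has conditional mean at
    most 1. Factors may depend on the first [k] observations, so that rules fitted on one subsample
    can be evaluated on the other. *)
Lemma indep_prod_le1 k q (psi : k.-tuple T * T -> R) :
  (k <= q <= n)%N -> measurable_fun setT psi -> (forall z, (0 <= psi z)%R) ->
  (forall t, \int[mu]_z (psi (t, z))%:E <= 1) ->
  \int[P]_w (\prod_(i < q | (k <= i)%N) psi (prefix k w, Z i w))%:E <= 1.
Proof.
move=> + mpsi psi0 psi1; elim: q => [|q ih] /andP[kq qn].
  under eq_integral do rewrite big_ord0.
  by rewrite (_ : (fun=> _) = cst 1)// integral_cst//= probability_setT mule1.
move: kq; rewrite leq_eqVlt => /predU1P[kq|]; last rewrite ltnS => kq.
  rewrite (_ : (fun w => _) = cst 1) ?integral_cst//=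
      ?probability_setT ?mule1//.
  apply/funext => w /=; rewrite big_pred0// => i.
  by rewrite kq leqNgt ltn_ord.
(* The earlier factors have to be a function of the first [q] observations, from which [p] recovers
   the first [k]. *)
pose p (t : q.-tuple T) : k.-tuple T := [tuple tnth t (widen_ord kq i) | i < k].
have pE w : p (prefix q w) = prefix k w.
  by apply: eq_from_tnth => i; rewrite !tnth_mktuple.
have mp : measurable_fun setT p.
  apply/measurable_fun_tnthP => i.
  rewrite (_ : _ \o _ = (@tnth q T ^~ (widen_ord kq i))).
    exact: measurable_tnth.
  by apply/funext => t /=; rewrite tnth_mktuple.
pose F (t : q.-tuple T) : R :=
    (\prod_(i < q | (k <= i)%N) psi (p t, tnth t i))%R.
have F0 t : (0 <= F t)%R by exact: prodr_ge0.
have mF : measurable_fun setT F.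
  rewrite /F; under eq_fun do rewrite -big_filter.
  apply: measurable_prod => i _; apply: measurableT_comp => //.
  by apply/measurable_fun_pair => //; exact: measurable_tnth.
have FE w : F (prefix q w) = (\prod_(i < q | (k <= i)%N) psi
    (prefix k w, Z i w))%R.
  by rewrite /F pE; apply: eq_bigr => i _; rewrite tnth_mktuple.
have mpsip : measurable_fun setT (fun z : q.-tuple T * T => psi (p z.1, z.2)).
  apply: measurableT_comp => //; apply/measurable_fun_pair => //.
  exact: measurableT_comp.
pose f (z : q.-tuple T * T) : \bar R := (F z.1 * psi (p z.1, z.2))%:E.
have f0 z : 0 <= f z by rewrite lee_fin mulr_ge0.
have mf : measurable_fun setT f.
  by apply/measurable_EFinP; apply: measurable_funM => //;
      exact: measurableT_comp.
rewrite (_ : (fun w => _) = fun w => f (prefix q w, Z q w)); last first.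
  by apply/funext => w; rewrite /f /=
      FE pE big_mkcond big_ord_recr -big_mkcond/= kq.
rewrite integral_prefix//.
apply: le_trans (ih _); last by rewrite kq ltnW.
apply: ge0_le_integral => //.
- by move=> w _; exact: integral_ge0.
- apply: (measurableT_comp (f := fun t => \int[mu]_z f (t, z))).
    exact: measurable_fun_fubini_tonelli_F.
  exact: measurable_prefix.
- apply/measurable_EFinP; under eq_fun do rewrite -FE.
  by apply: measurableT_comp => //; exact: measurable_prefix.
- move=> w _; rewrite -FE /f /=.
  under eq_integral do rewrite EFinM.
  rewrite ge0_integralZl_EFin//.
  + by rewrite -[leRHS]mule1 lee_wpmul2l// lee_fin.
  + by move=> z _; rewrite lee_fin.
  + apply/measurable_EFinP; apply: measurableT_comp => //.
Qed.

End independent_product.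

Lemma sumr_affine (R : realType) (k q : nat) (F : nat -> R) (lam a b : R) :
  \sum_(k <= j < q) (lam * F j - a - b) =
  lam * \sum_(k <= j < q) F j - (q - k)%:R * (a + b).
Proof.
rewrite sumrB sumrB -mulr_sumr !sumr_const_nat !mulr_natl mulrnDl.
by rewrite opprD addrA.
Qed.

(** Squaring [1 - x / 2 <= expR (- (x / 2))] gives [expR x * (1 - x / 2) ^+ 2 <= 1]. What remains is
    a polynomial inequality whose two sides differ by [x ^+ 2 * ((1 - x) * (5 / 4 - x / 2))]. *)
Lemma expR_le1Dx2 (R : realType) (x : R) : x <= 1 ->
  expR x <= 1 + x + 2 * x ^+ 2.
Proof.
move=> x1; have h0 : 0 < 1 - x / 2 by lra.
have h1 : 1 - x / 2 <= expR (- (x / 2)) by apply: expR_ge1Dx.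
have h2 : expR x * (1 - x / 2) ^+ 2 <= 1.
  rewrite -[leRHS](expRxMexpNx_1 x); apply: ler_wpM2l; first exact: expR_ge0.
  have -> : - x = - (x / 2) + - (x / 2) by field.
  by rewrite expRD expr2; apply: ler_pM => //; exact: ltW.
have h3 : 1 <= (1 + x + 2 * x ^+ 2) * (1 - x / 2) ^+ 2.
  rewrite -subr_ge0 (_ : _ - 1 = x ^+ 2 * ((1 - x) * (5 / 4 - x / 2)));
      last first.
    by field.
  by rewrite mulr_ge0 ?sqr_ge0// mulr_ge0//; lra.
rewrite -(ler_pM2r (exprn_gt0 2 h0)); exact: le_trans h2 h3.
Qed.

Section deviation.
Context dO (Omega : measurableType dO) (R : realType) (P : probability Omega R)
  d (T : measurableType d) (mu : probability T R) (Z : nat -> {RV P >-> T})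
  (n : nat).
Hypothesis iidZ : forall B : 'I_n -> set T, (forall i, measurable (B i)) ->
  P (\bigcap_(i in [set: 'I_n]) (Z i @^-1` B i)) = (\prod_(i < n) mu (B i))%E.
Local Notation prefix := (prefix Z).

(** The quadratic bound on the exponential is integrated, and the result, of the form [1 + c], is at
    most [expR c]. *)
Lemma mgf_le1 (g : T -> R) (lam : R) : measurable_fun setT g ->
  (forall z, `|g z| <= 1) -> 0 <= lam <= 1 ->
  (\int[mu]_z (expR (lam * g z - lam * (\int[mu]_z g z)%R
     - 2 * lam ^+ 2 * (\int[mu]_z (g z ^+ 2))%R))%:E <= 1)%E.
Proof.
move=> mg g1 /andP[lam0 lam1].
have g21 z : `|g z ^+ 2| <= 1 by rewrite normrX exprn_ile1.
have mg2 : measurable_fun setT (fun z => g z ^+ 2) by exact: measurable_funX.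
have ig := bounded_integrable mu mg g1.
have ig2 := bounded_integrable mu mg2 g21.
set p := (\int[mu]_z g z)%R; set v := (\int[mu]_z (g z ^+ 2))%R.
have bnd z : lam * g z <= 1.
  rewrite (le_trans (ler_norm _))// normrM (ger0_norm lam0).
  by rewrite mulr_ile1.
pose h z := 1 + lam * g z + 2 * lam ^+ 2 * g z ^+ 2.
have h0 z : 0 <= h z.
  rewrite /h; apply: le_trans (expR_ge0 (lam * g z)) _.
  by apply: le_trans (expR_le1Dx2 (bnd z)) _; rewrite exprMn mulrA.
have mh : measurable_fun setT h.
  by apply: measurable_funD; [apply: measurable_funD|]; rewrite //;
     apply: measurable_funM.
have ih : (\int[mu]_z (h z)%:E = (1 + lam * p + 2 * lam ^+ 2 * v)%:E)%E.
  have i1 : mu.-integrable setT (EFin \o (fun z => lam * g z)).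
    by apply: (@bounded_integrable _ _ _ _ _ 1) => [|z];
      [exact: measurable_funM|rewrite normrM (ger0_norm lam0) mulr_ile1].
  have i2 : mu.-integrable setT (EFin \o (fun z => 2 * lam ^+ 2 * g z ^+ 2)).
    apply: (@bounded_integrable _ _ _ _ _ (2 * lam ^+ 2 * 1)) => [|z].
      exact: measurable_funM.
    by rewrite normrM ger0_norm ?mulr_ge0 ?sqr_ge0// ler_wpM2l ?mulr_ge0
        ?sqr_ge0.
  have i0 : mu.-integrable setT (EFin \o (fun=> 1 : R)).
    by apply: (@bounded_integrable _ _ _ _ _ 1) => // z; rewrite normr1.
  under eq_integral do rewrite /h !EFinD.
  have pE : p%:E = (\int[mu]_z (g z)%:E)%E.
    by rewrite /p /Rintegral fineK//; exact: integrable_fin_num.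
  have vE : v%:E = (\int[mu]_z (g z ^+ 2)%:E)%E.
    by rewrite /v /Rintegral fineK//; exact: integrable_fin_num.
  rewrite integralD//=; last exact: integrableD.
  rewrite integralD//= (_ : (fun=> 1%:E) = cst 1%E)// integral_cst//=.
  rewrite probability_setT mule1 EFinD EFinD.
  congr (_ + _ + _)%E; under eq_integral do rewrite EFinM.
    by rewrite integralZl// EFinM pE.
  by rewrite integralZl// (EFinM _ v) vE.
apply: (@le_trans _ _ (\int[mu]_z
    ((expR (- (lam * p + 2 * lam ^+ 2 * v)))%:E * (h z)%:E))%E).
  apply: ge0_le_integral => //.
  - apply/measurable_EFinP; apply: measurableT_comp => //.
    apply: measurable_funB => //; apply: measurable_funB => //.
    exact: measurable_funM.
  - by apply/measurable_EFinP; exact: measurable_funM.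
  - move=> z _; rewrite -EFinM lee_fin.
    rewrite -addrA -opprD expRD mulrC ler_wpM2l ?expR_ge0//.
    by apply: le_trans (expR_le1Dx2 (bnd z)) _; rewrite exprMn mulrA.
rewrite ge0_integralZl_EFin ?expR_ge0//; last 2 first.
- by move=> z _; rewrite lee_fin.
- exact/measurable_EFinP.
set c := lam * p + 2 * lam ^+ 2 * v.
rewrite ih -EFinM lee_fin -addrA -/c -[leRHS]expR0 -[X in _ <= expR X](addNr c).
by rewrite expRD ler_wpM2l ?expR_ge0// expR_ge1Dx.
Qed.

Lemma measurable_section_mean k (g : k.-tuple T * T -> R) :
  measurable_fun setT g -> (forall z, `|g z| <= 1) ->
  measurable_fun setT (fun t => (\int[mu]_z g (t, z))%R).
Proof.
move=> mg g1.
(* Adding 1 makes the integrand nonnegative, so that the measurability part of Tonelli's theorem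
   applies. *)
have -> : (fun t => (\int[mu]_z g (t, z))%R) =
    (fun t => (\int[mu]_z (g (t, z) + 1))%R - 1).
  apply/funext => t; rewrite RintegralD//=.
  - have m1 : fine (mu setT) = 1 by rewrite probability_setT.
    by rewrite Rintegral_cst// [fine _]m1 mulr1 addrK.
  - apply: (@bounded_integrable _ _ _ _ _ 1) => // .
    by apply: measurableT_comp => //; exact: measurable_pair1.
  - by apply: (@bounded_integrable _ _ _ _ _ 1) => // z; rewrite normr1.
apply: measurable_funB => //.
apply: measurableT_comp; first exact: fine_measurable.
apply: (@measurable_fun_fubini_tonelli_F _ _ _ _ _ mu (fun z => (g z + 1)%:E)).
  by apply/measurable_EFinP; exact: measurable_funD.
by move=> z; rewrite lee_fin; have := g1 z; rewrite ler_norml; lra.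
Qed.

Lemma deviation k q (N : nat) (g : 'I_N -> k.-tuple T * T -> R) (lam s : R) :
  (k <= q <= n)%N -> (forall i, measurable_fun setT (g i)) ->
  (forall i z, `|g i z| <= 1) -> 0 < lam <= 1 -> 2 * N%:R <= expR s ->
  exists Y, mean_le P Y 1 /\ forall w i,
    `|\sum_(k <= j < q) g i (prefix k w, Z j w)
       - (q - k)%:R * (\int[mu]_z g i (prefix k w, z))%R|
    <= 2 * lam * (q - k)%:R * (\int[mu]_z (g i (prefix k w, z) ^+ 2))%R
       + (s + Y w) / lam.
Proof.
move=> kqn mg g1 /andP[lam0 lam1] Ns.
pose r : R := (q - k)%:R.
pose p (f : k.-tuple T * T -> R) t := (\int[mu]_z f (t, z))%R.
pose v (f : k.-tuple T * T -> R) t := (\int[mu]_z (f (t, z) ^+ 2))%R.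
pose psi f z := expR (lam * f z - lam * p f z.1 - 2 * lam ^+ 2 * v f z.1).
pose X f w := lam * (\sum_(k <= j < q) f (prefix k w, Z j w)
  - r * p f (prefix k w)) - 2 * lam ^+ 2 * r * v f (prefix k w).
have XE f w : expR (X f w) =
    \prod_(j < q | (k <= j)%N) psi f (prefix k w, Z j w).
  rewrite -expR_sum; congr expR.
  transitivity (\sum_(k <= j < q) (lam * f (prefix k w, Z j w)
      - lam * p f (prefix k w) - 2 * lam ^+ 2 * v f (prefix k w))); last first.
    by rewrite big_geq_mkord.
  rewrite sumr_affine /X -/r.
  by move: (v f _) (p f _) (\sum_(k <= j < q) _) => V M S; ring.
have mX (f : k.-tuple T * T -> R) : measurable_fun setT f ->
    (forall z, `|f z| <= 1) ->
    mean_le P (fun w => expR (X f w)) 1.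
  move=> mf f1.
  have f21 z : `|f z ^+ 2| <= 1 by rewrite normrX exprn_ile1.
  have mf2 : measurable_fun setT (fun z => f z ^+ 2) by exact: measurable_funX.
  have mp := measurable_section_mean mf f1.
  have mv := measurable_section_mean mf2 f21.
  have mpsi : measurable_fun setT (psi f).
    apply: measurableT_comp => //.
    apply: measurable_funB; first apply: measurable_funB.
    - exact: measurable_funM.
    - by apply: measurable_funM => //; exact: measurableT_comp.
    - by apply: measurable_funM => //; exact: measurableT_comp.
  split.
  - apply: measurableT_comp => //; apply: measurable_funB.
      apply: measurable_funM => //; apply: measurable_funB.
        apply: measurable_sum => j; apply: measurableT_comp => //.
        by apply/measurable_fun_pair => //; exact: measurable_prefix.
      by apply: measurable_funM => //; apply: measurableT_comp => //;
        exact: measurable_prefix.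
    by apply: measurable_funM => //; apply: measurableT_comp => //;
      exact: measurable_prefix.
  - by move=> w; exact: expR_ge0.
  - under eq_integral do rewrite XE.
    apply: (indep_prod_le1 iidZ) => //.
    + by move=> z; exact: expR_ge0.
    + move=> t; apply: mgf_le1; rewrite ?(ltW lam0)//.
      by apply: measurableT_comp => //; exact: measurable_pair1.
(* The sum stands in for a maximum over the [2 * N] signed variables: each exponential has mean at
   most 1 and [expR (- s)] compensates their number. Each variable satisfies
   [X - s <= expR (X - s)], which is at most this sum. *)
exists (fun w => expR (- s) * \sum_(i < N)
  (expR (X (g i) w) + expR (X (fun z => - g i z) w))); split.
  apply: (@mean_leS _ _ _ _ _ (expR (- s) * \sum_(i < N) (1 + 1))).
    apply: mean_leZ; first exact: expR_ge0.
    apply: mean_le_sum => i; apply: mean_leD; apply: mX => //.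
      exact: measurableT_comp.
    by move=> z; rewrite normrN.
  rewrite -[leRHS]expR0 -[X in _ <= expR X](addNr s) expRD.
  by rewrite sumr_const card_ord ler_wpM2l ?expR_ge0// -mulr_natr.
move=> w i.
have pN : p (fun z => - g i z) (prefix k w) = - p (g i) (prefix k w).
  rewrite /p -mulN1r -RintegralZl//;
      first by under [RHS]eq_Rintegral do rewrite mulN1r.
  apply: (@bounded_integrable _ _ _ _ _ 1) => // .
  by apply: measurableT_comp => //; exact: measurable_pair1.
have vN : v (fun z => - g i z) (prefix k w) = v (g i) (prefix k w).
  by rewrite /v; under eq_Rintegral do rewrite sqrrN.
set Y := expR (- s) * _.
have XY f : expR (X f w) <= \sum_(i < N)
    (expR (X (g i) w) + expR (X (fun z => - g i z) w)) -> X f w <= s + Y.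
  move=> h; rewrite -lerBlDl; apply:
      (@le_trans _ _ (expR (- s) * expR (X f w))).
    by rewrite -expRD (le_trans _ (expR_ge1Dx _))//; lra.
  by rewrite ler_wpM2l ?expR_ge0.
have S (F : 'I_N -> R) (F0 : forall i, 0 <= F i) : F i <= \sum_(i < N) F i.
  by rewrite (bigD1 i)//= lerDl sumr_ge0.
have X1 : X (g i) w <= s + Y.
  apply: XY; apply: le_trans (S _ _); first by rewrite lerDl expR_ge0.
  by move=> j; rewrite addr_ge0 ?expR_ge0.
have X2 : X (fun z => - g i z) w <= s + Y.
  apply: XY; apply: le_trans (S _ _); first by rewrite lerDr expR_ge0.
  by move=> j; rewrite addr_ge0 ?expR_ge0.
move: X1 X2; rewrite /X pN vN sumrN -/r -/(p _ _) -/(v _ _).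
move: (\sum_(k <= j < q) _) (p _ _) (v _ _) => A B V X1 X2.
have E : lam * (2 * lam * r * V + (s + Y) / lam) = 2 * lam ^+ 2 * r * V +
    (s + Y).
  by field; rewrite gt_eqF.
rewrite -(ler_pM2l lam0) E -{1}(gtr0_norm lam0) -normrM ler_norml.
by apply/andP; split; lra.
Qed.

End deviation.

(** * Excess risk *)

Section excess.
Context {R : realType} {d : nat} (pi : probability (obs R d) R).
Local Notation X := (Rspace R d).
Implicit Types (A B : set X) (z : obs R d).

(** Up to a term free of [A], the 0-1 loss of the classifier of [A] is minus the label times the
    indicator of [A]. So [gap A B] is the loss of [B] minus that of [A], its square is the indicator
    of the symmetric difference, and [agreement] is a constant minus the risk. *)
Definition gap A B z : R := lab R z.2 * (\1_A z.1 - \1_B z.1).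
Definition disagreement A B : R := \int[pi]_z (gap A B z ^+ 2).
Definition agreement A : R := \int[pi]_z (lab R z.2 * \1_A z.1).

Lemma lab_sqr (y : bool) : lab R y ^+ 2 = 1.
Proof. by case: y; rewrite /lab ?sqrrN expr1n. Qed.

Lemma indic_bool A x : \1_A x = 0 :> R \/ \1_A x = 1 :> R.
Proof. by rewrite indicE; case: (_ \in _); [right|left]. Qed.

Lemma gap_sqr A B z : gap A B z ^+ 2 = (\1_A z.1 - \1_B z.1) ^+ 2.
Proof. by rewrite exprMn lab_sqr mul1r. Qed.

Lemma normr_gap A B z : `|gap A B z| <= 1.
Proof.
rewrite -(expr_le1 (n := 2))// -normrX gap_sqr.
by case: (indic_bool A z.1) => ->; case: (indic_bool B z.1) => ->;
  rewrite ?subrr ?subr0 ?sub0r ?sqrrN ?expr1n ?expr0n ?normr0 ?normr1.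
Qed.

Lemma gap_le_sqr A B z : gap A B z <= gap A B z ^+ 2.
Proof.
rewrite gap_sqr /gap /lab.
by case: (indic_bool A z.1) => ->; case: (indic_bool B z.1) => ->;
  case: z.2 => /=; nra.
Qed.

Lemma gap_sqr_indic A B z : gap A B z ^+ 2 = \1_(A `+` B) z.1.
Proof.
rewrite gap_sqr !indicE.
case: (boolP (z.1 \in A)); case: (boolP (z.1 \in B)); rewrite ?inE ?notin_setE;
  move=> hB hA; [rewrite memNset|rewrite mem_set|rewrite mem_set|rewrite
      memNset];
  rewrite /= ?subrr ?subr0 ?sub0r ?sqrrN ?expr1n ?expr0n//=; rewrite /setY/=;
      tauto.
Qed.

Lemma measurable_lab : measurable_fun setT (fun z : obs R d => lab R z.2).
Proof. by apply: (measurableT_comp (f := @lab R)). Qed.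

Lemma measurable_indic_fst A : measurable A ->
  measurable_fun setT (fun z : obs R d => \1_A z.1 : R).
Proof.
move=> mA; have h : measurable_fun setT (\1_A : X -> R)
    by exact: measurable_indic.
exact: (measurableT_comp h measurable_fst).
Qed.

Lemma measurable_gap A B : measurable A -> measurable B ->
  measurable_fun setT (gap A B).
Proof.
move=> mA mB; apply: measurable_funM; first exact: measurable_lab.
by apply: measurable_funB; exact: measurable_indic_fst.
Qed.

Lemma normr_lab_indic A z : `|lab R z.2 * \1_A z.1| <= 1.
Proof.
rewrite (_ : _ * _ = gap A set0 z) ?normr_gap//.
by rewrite /gap indic0 subr0.
Qed.

Lemma integrable_lab_indic A : measurable A ->
  pi.-integrable setT (EFin \o (fun z => lab R z.2 * \1_A z.1)).
Proof.
move=> mA; apply: (@bounded_integrable _ _ _ _ _ 1);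
    last exact: normr_lab_indic.
apply: measurable_funM; first exact: measurable_lab.
exact: measurable_indic_fst.
Qed.

Lemma integrable_gap A B : measurable A -> measurable B ->
  pi.-integrable setT (EFin \o gap A B).
Proof.
move=> mA mB; apply: (@bounded_integrable _ _ _ _ _ 1); last exact: normr_gap.
exact: measurable_gap.
Qed.

Lemma integrable_gap_sqr A B : measurable A -> measurable B ->
  pi.-integrable setT (EFin \o (fun z => gap A B z ^+ 2)).
Proof.
move=> mA mB; apply: (@bounded_integrable _ _ _ _ _ 1) => [|z].
  by apply: measurable_funX; exact: measurable_gap.
by rewrite normrX exprn_ile1// normr_gap.
Qed.

Lemma integral_gap A B : measurable A -> measurable B ->
  \int[pi]_z gap A B z = agreement A - agreement B.
Proof.
move=> mA mB; rewrite /agreement -RintegralB//; do ?exact: integrable_lab_indic.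
by apply: eq_Rintegral => z _; rewrite /gap mulrBr.
Qed.

Lemma agreement_le_disagreement A B : measurable A -> measurable B ->
  agreement A - agreement B <= disagreement A B.
Proof.
move=> mA mB; rewrite -integral_gap//; apply: le_Rintegral => //.
- exact: integrable_gap.
- exact: integrable_gap_sqr.
- by move=> z _; exact: gap_le_sqr.
Qed.

Lemma disagreementC A B : disagreement A B = disagreement B A.
Proof.
by apply: eq_Rintegral => z _; rewrite !gap_sqr -sqrrN opprB.
Qed.

Lemma disagreement_ge0 A B : 0 <= disagreement A B.
Proof. by apply: Rintegral_ge0 => z _; exact: sqr_ge0. Qed.

Lemma disagreement_triangle A B C :
  measurable A -> measurable B -> measurable C ->
  disagreement A C <= disagreement A B + disagreement B C.
Proof.
move=> mA mB mC; rewrite /disagreement -RintegralD//;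
    do ?exact: integrable_gap_sqr.
apply: le_Rintegral => //.
- exact: integrable_gap_sqr.
- apply: (@bounded_integrable _ _ _ _ _ 2) => [|z].
    by apply: measurable_funD; apply: measurable_funX; exact: measurable_gap.
  apply: le_trans (ler_normD _ _) _; rewrite [leRHS](_ : 2 = 1 + 1)//.
  by rewrite lerD// normrX exprn_ile1// normr_gap.
- move=> z _; rewrite !gap_sqr.
  by case: (indic_bool A z.1) => ->; case: (indic_bool B z.1) => ->;
    case: (indic_bool C z.1) => ->; nra.
Qed.

Lemma disagreementE A B : measurable A -> measurable B ->
  (disagreement A B)%:E = d_Delta (marginal pi) A B.
Proof.
move=> mA mB.
have mAB : measurable (A `+` B) by apply: measurableU; exact: measurableD.
rewrite /disagreement; under eq_Rintegral do rewrite gap_sqr_indic.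
rewrite /d_Delta /marginal /pushforward.
transitivity (\int[pi]_z (\1_(fst @^-1` (A `+` B)) z)%:E)%E.
  rewrite /Rintegral fineK//; apply: integrable_fin_num => //.
  apply: (@bounded_integrable _ _ _ _ _ 1) => [|z];
      first exact: measurable_indic_fst.
  by case: (indic_bool (A `+` B) z.1) => ->; rewrite ?normr0 ?normr1.
rewrite integral_indic ?setIT//.
by rewrite -[X in measurable X]setTI; exact: measurable_fst.
Qed.

Lemma disagreement_le1 A B : measurable A -> measurable B ->
  disagreement A B <= 1.
Proof.
move=> mA mB; rewrite -lee_fin disagreementE//; apply: probability_le1.
rewrite -[X in measurable X]setTI; apply: measurable_fst => //.
by apply: measurableU; exact: measurableD.
Qed.

End excess.

Section bayes_excess.
Context {R : realType} {d : nat} (pi : probability (obs R d) R)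
  (eta : Rspace R d -> R).
Hypothesis eta_reg : regression_function pi eta.
Local Notation X := (Rspace R d).
Implicit Types (A B : set X) (z : obs R d).
Local Notation G := (bayes_set eta).

Definition set_excess A : R := agreement pi G - agreement pi A.

Let meta : measurable_fun setT eta. Proof. by case: eta_reg. Qed.
Let eta01 x : 0 <= eta x <= 1. Proof. by case: eta_reg. Qed.

Lemma measurable_bayes_set : measurable G.
Proof.
rewrite (_ : G = eta @^-1` `]2^-1, +oo[).
  by rewrite -[X in measurable X]setTI; exact: meta.
by apply/seteqP; split => x; rewrite /bayes_set /= in_itv/= andbT.
Qed.

Lemma normr_regression_indic A z : `|(2 * eta z.1 - 1) * \1_A z.1| <= 1.
Proof.
rewrite normrM mulr_ile1// ?ler_norml.
- by have := eta01 z.1; lra.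
- by case: (indic_bool A z.1) => -> ; apply/andP; split; lra.
Qed.

Lemma integrable_regression_indic A : measurable A ->
  pi.-integrable setT (EFin \o (fun z => (2 * eta z.1 - 1) * \1_A z.1)).
Proof.
move=> mA; apply: (@bounded_integrable _ _ _ _ _ 1).
  apply: measurable_funM; last exact: measurable_indic_fst.
  apply: measurable_funB => //; apply: measurable_funM => //.
  exact: (measurableT_comp meta measurable_fst).
exact: normr_regression_indic.
Qed.

(** The label is twice the indicator of the label 1, minus 1; the identity defining [eta], taken on
    [A], replaces that indicator by its conditional mean. *)
Lemma agreementE A : measurable A ->
  agreement pi A = \int[pi]_z ((2 * eta z.1 - 1) * \1_A z.1).
Proof.
move=> mA; have [_ _ reg] := eta_reg.
have mA1 : measurable (A `*` [set true]) by exact: measurableX.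
have mAT : measurable (fst @^-1` A : set (obs R d)).
  by rewrite -[X in measurable X]setTI; exact: measurable_fst.
have ii (S : set (obs R d)) : measurable S ->
    pi.-integrable setT (EFin \o (\1_S : obs R d -> R)).
  move=> mS; apply: (@bounded_integrable _ _ _ _ _ 1) => [|z].
    exact: measurable_indic.
  by rewrite indicE; case: (_ \in _); rewrite ?normr0 ?normr1.
have IB (S : set (obs R d)) : measurable S ->
    \int[pi]_z (\1_S z : R) = fine (pi S).
  by move=> mS; rewrite /Rintegral integral_indic// setIT.
have i_eta : pi.-integrable setT (EFin \o (fun z => eta z.1 * \1_A z.1)).
  apply: (@bounded_integrable _ _ _ _ _ 1) => [|z].
    apply: measurable_funM; last exact: measurable_indic_fst.
    exact: (measurableT_comp meta measurable_fst).
  by have := eta01 z.1; case: (indic_bool A z.1) => ->; rewrite ler_norml;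
    lra.
have Ieta : \int[pi]_z (eta z.1 * \1_A z.1) = fine (pi (A `*` [set true])).
  rewrite reg// /Rintegral; congr fine.
  rewrite [RHS]integral_mkcond; apply: eq_integral => z _.
  rewrite /patch indicE; have [zA|zA] := boolP (z.1 \in A).
    by rewrite mulr1 mem_set//; exact: set_mem.
  by rewrite mulr0 memNset// => h; case/negP: zA; exact: mem_set.
transitivity (2 * fine (pi (A `*` [set true])) - fine (pi (fst @^-1` A))).
  rewrite -!IB// -RintegralZl//; last exact: ii.
  rewrite -RintegralB//; last 2 first.
  - apply: (@bounded_integrable _ _ _ _ _ 2) => [|z].
      by apply: measurable_funM => //; exact: measurable_indic.
    by rewrite indicE; case: (_ \in _);
        rewrite ?mulr0 ?normr0// mulr1 ger0_norm.
  - exact: ii.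
  apply: eq_Rintegral => -[x y] _ /=.
  have -> : \1_(A `*` [set true]) (x, y) = (y%:R : R) * \1_A x.
    rewrite !indicE; case: y => /=; rewrite ?mul1r ?mul0r.
      by congr ((nat_of_bool _)%:R); apply/idP/idP; rewrite !inE => //; case.
    by rewrite memNset// => -[].
  have -> : \1_(fst @^-1` A) (x, y) = \1_A x :> R.
    by rewrite !indicE; congr (_%:R).
  by case: y; rewrite /lab /=; ring.
rewrite -Ieta -IB// -RintegralZl// -RintegralB//; last 2 first.
- apply: (@bounded_integrable _ _ _ _ _ 2) => [|z].
    apply: measurable_funM => //; apply: measurable_funM;
        last exact: measurable_indic_fst.
    exact: (measurableT_comp meta measurable_fst).
  by have := eta01 z.1; case: (indic_bool A z.1) => ->; rewrite ler_norml; lra.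
- exact: ii.
apply: eq_Rintegral => z _.
have -> : \1_(fst @^-1` A) z = \1_A z.1 :> R by rewrite !indicE; congr (_%:R).
by ring.
Qed.

Lemma sign1_ge0 (t : R) : (0 <= sign1 t) = (0 <= t).
Proof. by rewrite /sign1; case: ifP => // _; lra. Qed.

(** Pointwise, the error indicator is that of the label 1 minus the label times the indicator of
    predicting 1. The inequality is weak because [sign1] sends 0 to 1. *)
Lemma riskE (f : X -> R) : measurable [set x | 0 <= f x] ->
  risk pi f = fine (pi (setT `*` [set true])) - agreement pi [set x | 0 <= f x].
Proof.
set A := [set x | _] => mA; rewrite /risk.
have mT : measurable (setT `*` [set true] : set (obs R d))
    by exact: measurableX.
have EA z : (lab R z.2 != sign1 (f z.1) :> R)%:R =
    \1_(setT `*` [set true]) z - lab R z.2 * \1_A z.1 :> R.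
  rewrite !indicE.
  have -> : (z.1 \in A) = (0 <= f z.1) by apply/idP/idP; rewrite inE.
  have -> : (z \in setT `*` [set true]) = z.2.
    by apply/idP/idP; rewrite inE /=; [case=> _ ->|case: z => x [] //].
  rewrite /lab /sign1; case: z.2; case: (0 <= f z.1); rewrite /= ?eqxx//=.
  - by rewrite mulr1 subrr.
  - by rewrite (_ : (1 != -1 :> R) = true) ?mulr0 ?subr0//; apply/eqP; lra.
  - by rewrite (_ : (-1 != 1 :> R) = true) ?mulr1 ?sub0r ?opprK//; apply/eqP;
      lra.
  - by rewrite mulr0 subr0.
have iT : pi.-integrable setT (EFin \o
    (\1_(setT `*` [set true]) : obs R d -> R)).
  apply: (@bounded_integrable _ _ _ _ _ 1) => [|z];
      first exact: measurable_indic.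
  by rewrite indicE; case: (_ \in _); rewrite ?normr0 ?normr1.
have mS : measurable [set z : obs R d | lab R z.2 != sign1 (f z.1)].
  rewrite (_ : [set _ | _] = (fun z : obs R d =>
      \1_(setT `*` [set true]) z - lab R z.2 * \1_A z.1 : R) @^-1` [set 1]).
    rewrite -[X in measurable X]setTI.
    suff mf : measurable_fun setT (fun z : obs R d =>
      \1_(setT `*` [set true]) z - lab R z.2 * \1_A z.1 : R) by exact: mf.
    apply: measurable_funB; first exact: measurable_indic.
    apply: measurable_funM; first exact: measurable_lab.
    exact: measurable_indic_fst.
  by apply/seteqP; split => z /=; rewrite -EA; case: (_ != _) => // /eqP;
    rewrite eq_sym oner_eq0.
transitivity (\int[pi]_z (\1_(setT `*` [set true]) z - lab R z.2 * \1_A z.1)).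
  rewrite /Rintegral; congr fine;
      rewrite -(setIT [set z | _]) -integral_indic//.
  apply: eq_integral => z _; rewrite -EA indicE; congr ((nat_of_bool _)%:R%:E).
  by apply/idP/idP; rewrite inE.
rewrite RintegralB//; last exact: integrable_lab_indic.
by rewrite /Rintegral integral_indic// setIT.
Qed.

Lemma measurable_bayes_pos : measurable [set x | 0 <= 2 * eta x - 1].
Proof.
rewrite (_ : [set x | _] = eta @^-1` `[2^-1, +oo[).
  by rewrite -[X in measurable X]setTI; exact: meta.
by apply/seteqP; split => x /=; rewrite in_itv/= andbT => h; [lra|lra].
Qed.

(** The Bayes classifier also predicts 1 where [eta] is 1/2, outside [bayes_set]; there
    [2 * eta - 1] vanishes, so both sets have the same agreement. *)
Lemma risk_bayes :
  risk pi (bayes eta) = fine (pi (setT `*` [set true])) - agreement pi G.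
Proof.
have E : [set x | 0 <= bayes eta x] = [set x | 0 <= 2 * eta x - 1].
  by apply/seteqP; split => x; rewrite /bayes /= sign1_ge0.
rewrite riskE E; last exact: measurable_bayes_pos.
congr (_ - _); rewrite !agreementE;
    [|exact: measurable_bayes_set|exact: measurable_bayes_pos].
apply: eq_Rintegral => z _; rewrite !indicE.
have [h|h] := eqVneq (2 * eta z.1 - 1) 0; first by rewrite h !mul0r.
congr (_ * (nat_of_bool _)%:R); apply/idP/idP; rewrite !inE /bayes_set /=;
    last by lra.
move=> h0; suff : 0 < 2 * eta z.1 - 1 by lra.
by rewrite lt_def h.
Qed.

Lemma excess_riskE (f : X -> R) : measurable [set x | 0 <= f x] ->
  excess_risk pi eta f = set_excess [set x | 0 <= f x].
Proof.
by move=> mf; rewrite /excess_risk riskE// risk_bayes /set_excess; ring.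
Qed.

Lemma set_excessE A : measurable A -> set_excess A =
  \int[pi]_z ((2 * eta z.1 - 1) * \1_G z.1 - (2 * eta z.1 - 1) * \1_A z.1).
Proof.
move=> mA; have mG := measurable_bayes_set.
by rewrite /set_excess !agreementE// RintegralB//;
    exact: integrable_regression_indic.
Qed.

Lemma set_excess_ge0 A : measurable A -> 0 <= set_excess A.
Proof.
move=> mA; rewrite set_excessE//; apply: Rintegral_ge0 => z _.
rewrite !indicE; have [zG|zG] := boolP (z.1 \in G).
  have : 2^-1 < eta z.1 by move: zG; rewrite inE.
  by case: (_ \in A) => /=; lra.
have : eta z.1 <= 2^-1 by rewrite leNgt; apply: contra zG; rewrite inE.
by case: (_ \in A) => /=; lra.
Qed.

Lemma set_excess_le_disagreement A : measurable A ->
  set_excess A <= disagreement pi A G.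
Proof.
move=> mA; rewrite disagreementC; apply: agreement_le_disagreement => //.
exact: measurable_bayes_set.
Qed.

(* Where the weighted vote errs, the erring classifiers carry at least half of
   the total weight. *)
Lemma excess_weighted_vote (M : nat) (w : 'I_M -> R) (A : 'I_M -> set X) :
  (forall j, 0 <= w j) -> \sum_j w j = 1 -> (forall j, measurable (A j)) ->
  excess_risk pi eta (fun x => \sum_(j < M) w j * set_classifier R (A j) x)
    <= 2 * \sum_(j < M) w j * set_excess (A j).
Proof.
move=> w0 w1 mA; set f := (fun x => _).
have fE x : f x = 2 * (\sum_(j < M) w j * \1_(A j) x) - 1.
  rewrite /f /set_classifier; under eq_bigr do rewrite mulrBr mulr1 mulrCA.
  by rewrite sumrB -mulr_sumr w1.
have mf : measurable_fun setT f.
  apply: measurable_sum => j; apply: measurable_funM => //.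
  by apply: measurable_funB => //; exact: measurable_funM.
have mF : measurable [set x | 0 <= f x].
  rewrite (_ : [set x | _] = f @^-1` `[0, +oo[).
    by rewrite -[X in measurable X]setTI; exact: mf.
  by apply/seteqP; split => x; rewrite /= in_itv/= andbT.
have mG := measurable_bayes_set.
(* The excess risk of [A] conditionally on the point. *)
pose h A z := (2 * eta z.1 - 1) * \1_G z.1 - (2 * eta z.1 - 1) * \1_A z.1.
have ih B : measurable B -> pi.-integrable setT (EFin \o h B).
  move=> mB; have := integrableB measurableT (integrable_regression_indic mG)
    (integrable_regression_indic mB).
  by apply: eq_integrable.
have IS n (v : 'I_n -> R) (B : 'I_n -> set X) : (forall j, measurable (B j)) ->
    pi.-integrable setT (EFin \o (fun z => \sum_(j < n) v j * h (B j) z)) /\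
    \int[pi]_z (\sum_(j < n) v j * h (B j) z) =
        \sum_(j < n) v j * set_excess (B j).
  elim: n v B => [|n ihn] v B mB.
    split.
      apply: (@eq_integrable _ _ _ _ _ measurableT (cst 0%E)).
        by move=> z _; rewrite /= big_ord0.
      exact: integrable0.
    under eq_Rintegral do rewrite big_ord0.
    by rewrite big_ord0 Rintegral_cst// mul0r.
  have [i1 e1] := ihn (fun j => v (widen_ord (leqnSn n) j))
    (fun j => B (widen_ord (leqnSn n) j)) (fun j => mB _).
  have i2 : pi.-integrable setT (EFin \o
      (fun z => v ord_max * h (B ord_max) z)).
    have -> : EFin \o (fun z => v ord_max * h (B ord_max) z) =
       (fun z => (v ord_max)%:E * (EFin \o h (B ord_max)) z)%E by [].
    by apply: integrableZl => //; exact: ih.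
  split.
    under eq_fun do rewrite big_ord_recr /=.
    have := integrableD measurableT i1 i2.
    by apply: eq_integrable => // z _ /=; rewrite big_ord_recr.
  under eq_Rintegral do rewrite big_ord_recr /=.
  rewrite RintegralD// e1 RintegralZl//; last exact: ih.
  by rewrite big_ord_recr/= (set_excessE (mB ord_max)).
have [i1 e1] := IS M w A mA.
rewrite excess_riskE// set_excessE// -e1 -RintegralZl//.
apply: le_Rintegral => //; first exact: ih.
  have := integrableZl measurableT 2 i1.
  by apply: eq_integrable.
move=> z _.
have -> : \sum_(j < M) w j * h (A j) z =
    (2 * eta z.1 - 1) * (\1_G z.1 - \sum_(j < M) w j * \1_(A j) z.1).
  rewrite /h mulrBr mulr_sumr.
  under eq_bigr do rewrite mulrBr.
  rewrite sumrB -mulr_suml w1 mul1r; congr (_ - _).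
  by apply: eq_bigr => j _; rewrite mulrCA.
have S0 : 0 <= \sum_(j < M) w j * \1_(A j) z.1.
  by apply: sumr_ge0 => j _; rewrite mulr_ge0// indicE ler0n.
have S1 : \sum_(j < M) w j * \1_(A j) z.1 <= 1.
  by rewrite -[leRHS]w1; apply: ler_sum => j _; apply: ler_piMr.
(* [S] is the weight of the votes for 1, and the aggregate predicts 1 exactly when [S] is at least
   1/2. *)
have := fE z.1; move: (\sum_(j < M) _) S0 S1 => S S0 S1 fS.
rewrite !indicE.
have -> : (z.1 \in [set x | 0 <= f x]) = (0 <= f z.1) by apply/idP/idP;
    rewrite inE.
rewrite fS; have [zG|zG] := boolP (z.1 \in G).
  have : 2^-1 < eta z.1 by move: zG; rewrite inE.
  by case: (lerP 0 (2 * S - 1)) => /=; nra.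
have : eta z.1 <= 2^-1 by rewrite leNgt; apply: contra zG; rewrite inE.
by case: (lerP 0 (2 * S - 1)) => /=; nra.
Qed.

Section margin.
Variables (kappa c : R).
Hypothesis k1 : 1 <= kappa.
Hypothesis c0 : 0 < c.
Hypothesis mrg : margin_assumption kappa c pi eta.

(** The set where the Bayes classifier is 1. The classifiers of [A] and [B] differ by 2 on the
    symmetric difference, whence the [c / 2] below. *)
Let B := [set x | 0 <= 2 * eta x - 1].

Let margin_B A : measurable A ->
  disagreement pi A B <= c / 2 * set_excess A `^ (kappa^-1).
Proof.
move=> mA; have mB := measurable_bayes_pos.
have mf : measurable_fun setT (set_classifier R A).
  by apply: measurable_funB => //; exact: measurable_funM.
have fA : [set x | 0 <= set_classifier R A x] = A.
  apply/seteqP; split => x; rewrite /set_classifier /= indicE.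
    by have [xA _|_] := boolP (x \in A); [exact: set_mem|rewrite mulr0; lra].
  by move=> xA; rewrite mem_set// mulr1; lra.
have f1 x : set_classifier R A x = 1 \/ set_classifier R A x = -1.
  by rewrite /set_classifier; case: (indic_bool A x) => ->; [right|left]; lra.
have := mrg mf f1; rewrite excess_riskE fA// unlock.
have mgB : measurable_fun setT (fun z => gap A B z ^+ 2).
  by apply: measurable_funX; exact: measurable_gap.
rewrite (eq_integral (fun z => (2%:E * (gap A B z ^+ 2)%:E)%E)); last first.
  move=> z _; rewrite -EFinM gap_sqr /set_classifier /bayes /sign1; congr EFin.
  have -> : (0 <= 2 * eta z.1 - 1) = (z.1 \in B) by apply/idP/idP; rewrite inE.
  rewrite [\1_B _]indicE; case: (_ \in B); case: (indic_bool A z.1) => -> /=.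
  - by rewrite ler0_norm; lra.
  - by rewrite ger0_norm; lra.
  - by rewrite ger0_norm; lra.
  - by rewrite ger0_norm; lra.
rewrite ge0_integralZl_EFin//; last 2 first.
  by move=> z _; rewrite lee_fin sqr_ge0.
  exact/measurable_EFinP.
rewrite (_ : (\int[pi]_z _)%E = (disagreement pi A B)%:E); last first.
  rewrite /disagreement /Rintegral fineK//; apply: integrable_fin_num => //.
  exact: integrable_gap_sqr.
by rewrite -EFinM lee_fin => h; rewrite -mulrA mulrCA ler_pdivlMl.
Qed.

Lemma margin_disagreement A : measurable A ->
  disagreement pi A G `^ kappa <= (c / 2) `^ kappa * set_excess A.
Proof.
move=> mA; have mB := measurable_bayes_pos; have mG := measurable_bayes_set.
have k0 : kappa != 0 by rewrite gt_eqF// (lt_le_trans _ k1).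
(* The Bayes set has no excess risk, so the margin assumption applied to it makes [G] and [B] differ
   by a null set, and [B] can be replaced by [G]. *)
have GB : disagreement pi G B <= 0.
  apply: le_trans (margin_B mG) _.
  by rewrite /set_excess subrr powR0 ?mulr0// invr_eq0.
have AG : disagreement pi A G <= c / 2 * set_excess A `^ kappa^-1.
  apply: le_trans (disagreement_triangle pi mA mB mG) _.
  rewrite (disagreementC pi B G); apply: le_trans (margin_B mA).
  by rewrite gerDl.
apply: le_trans (ge0_ler_powR _ _ _ AG) _.
- by rewrite (le_trans _ k1).
- by rewrite nnegrE disagreement_ge0.
- by rewrite nnegrE mulr_ge0 ?powR_ge0// divr_ge0// ltW.
rewrite powRM ?powR_ge0//; last by rewrite divr_ge0// ltW.
by rewrite -powRrM mulVf// powRr1// set_excess_ge0.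
Qed.

End margin.

End bayes_excess.

(** * Chaining *)

Section chaining.
Context {R : realType} {d : nat} (pi : probability (obs R d) R)
  dO (Omega : measurableType dO) (P : probability Omega R)
  (Z : nat -> {RV P >-> obs R d}) (n : nat).
Hypothesis iidZ : iid_sample pi Z n.
Local Notation X := (Rspace R d).
Implicit Types (A B G : set X) (z : obs R d).

Definition agreement_sum (z : nat -> obs R d) (k q : nat) A : R :=
  \sum_(k <= j < q) (lab R (z j).2 * \1_A (z j).1).

Lemma sum_gap (z : nat -> obs R d) k q A B :
  \sum_(k <= j < q) gap A B (z j) =
  agreement_sum z k q A - agreement_sum z k q B.
Proof.
rewrite /agreement_sum -sumrB; apply: eq_bigr => j _.
by rewrite /gap mulrBr.
Qed.

Lemma deviation_gap m (N : nat) (A B : nat -> set X) (lam s : R) :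
  (m <= n)%N -> (forall i, (i < N)%N -> measurable (A i)) ->
  (forall i, (i < N)%N -> measurable (B i)) ->
  0 < lam <= 1 -> 2 * N%:R <= expR s ->
  exists Y, mean_le P Y 1 /\ forall w i, (i < N)%N ->
    `|agreement_sum (Z ^~ w) 0 m (A i) - agreement_sum (Z ^~ w) 0 m (B i)
       - m%:R * (agreement pi (A i) - agreement pi (B i))|
    <= 2 * lam * m%:R * disagreement pi (A i) (B i) + (s + Y w) / lam.
Proof.
move=> mn mA mB lam01 Ns.
have mg (i : 'I_N) : measurable_fun setT
    (fun z : 0.-tuple (obs R d) * obs R d => gap (A i) (B i) z.2).
  exact: (measurableT_comp (measurable_gap (mA i (ltn_ord i))
      (mB i (ltn_ord i)))
    measurable_snd).
have g1 (i : 'I_N) (z : 0.-tuple (obs R d) * obs R d) :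
    `|gap (A i) (B i) z.2| <= 1 by exact: normr_gap.
have [Y [Y1 YE]] := deviation iidZ (k := 0) (q := m) (N := N) mn mg g1 lam01 Ns.
exists Y; split=> // w i iN; have := YE w (Ordinal iN).
by rewrite /= sum_gap subn0 integral_gap//; [exact: mA|exact: mB].
Qed.

Lemma deviation_gap_sqr m (N : nat) (A B : nat -> set X) (lam s : R) :
  (m <= n)%N -> (forall i, (i < N)%N -> measurable (A i)) ->
  (forall i, (i < N)%N -> measurable (B i)) ->
  0 < lam <= 1 -> 2 * N%:R <= expR s ->
  exists Y, mean_le P Y 1 /\ forall w i, (i < N)%N ->
    `|\sum_(0 <= j < m) gap (A i) (B i) (Z j w) ^+ 2
       - m%:R * disagreement pi (A i) (B i)|
    <= 2 * lam * m%:R * disagreement pi (A i) (B i) + (s + Y w) / lam.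
Proof.
move=> mn mA mB lam01 Ns.
have mg (i : 'I_N) : measurable_fun setT
    (fun z : 0.-tuple (obs R d) * obs R d => gap (A i) (B i) z.2 ^+ 2).
  apply: measurable_funX.
  exact: (measurableT_comp (measurable_gap (mA i (ltn_ord i))
      (mB i (ltn_ord i)))
    measurable_snd).
have g1 (i : 'I_N) (z : 0.-tuple (obs R d) * obs R d) :
    `|gap (A i) (B i) z.2 ^+ 2| <= 1.
  by rewrite normrX exprn_ile1// normr_gap.
have [Y [Y1 YE]] := deviation iidZ (k := 0) (q := m) (N := N) mn mg g1 lam01 Ns.
exists Y; split=> // w i iN; have := YE w (Ordinal iN).
(* An indicator is its own square, so the second moment is again the disagreement. *)
rewrite /= subn0 (_ : \int[pi]_z ((gap (A i) (B i) z ^+ 2) ^+ 2) =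
  disagreement pi (A i) (B i))//.
apply: eq_Rintegral => z _; rewrite gap_sqr_indic.
by case: (indic_bool (A i `+` B i) z.1) => ->; rewrite ?expr0n ?expr1n.
Qed.

Lemma normr_gap_bracket A B G z : A `<=` G -> G `<=` B ->
  `|gap G A z| <= gap A B z ^+ 2.
Proof.
move=> AG GB; rewrite normrM (_ : `|lab R z.2| = 1); last first.
  by apply/eqP; rewrite -(eqrXn2 (n := 2))// -normrX lab_sqr normr1 expr1n.
rewrite mul1r gap_sqr !indicE.
have [zA|zA] := boolP (z.1 \in A).
  have -> : z.1 \in G by rewrite inE; apply: AG; rewrite inE in zA.
  by rewrite subrr normr0 sqr_ge0.
have [zG|zG] := boolP (z.1 \in G).
  have -> : z.1 \in B by rewrite inE; apply: GB; rewrite inE in zG.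
  by rewrite subr0 sub0r sqrrN normr1 expr1n.
by rewrite subrr normr0 sqr_ge0.
Qed.

Lemma disagreement_bracket A B G :
  measurable A -> measurable B -> measurable G -> A `<=` G -> G `<=` B ->
  disagreement pi G A <= disagreement pi A B.
Proof.
move=> mA mB mG AG GB; apply: le_Rintegral => //.
- exact: integrable_gap_sqr.
- exact: integrable_gap_sqr.
- move=> z _; apply: le_trans (normr_gap_bracket z AG GB).
  rewrite -(ger0_norm (sqr_ge0 (gap G A z))) normrX expr2.
  by rewrite ler_piMr// normr_gap.
Qed.

Lemma pair_index_lt a b i j : (i < a)%N -> (j < b)%N -> (i * b + j < a * b)%N.
Proof.
move=> ia jb; apply: (@leq_trans (i.+1 * b)); last by rewrite leq_mul2r ia orbT.
by rewrite mulSn addnC ltn_add2r.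
Qed.

Section chain.
Variables (m K : nat) (N : nat -> nat) (L U : nat -> nat -> set X)
  (calY : set (set X)) (G0 : set X).
(** [dl k] is the bracket width, [lam k] the deviation exponent and [H k] bounds the log-number of
    brackets at step [k]. The width is halved while the exponent grows by [2 * q], so [lam k * dl k]
    decreases like [q ^+ k] and the whole chain costs a multiple of [e]. [HB] matches entropy with
    variance at each scale. *)
Variables (dl lam H : nat -> R) (B e q tau : R).
Hypothesis mn : (m <= n)%N.
Hypothesis mG0 : measurable G0.
Hypothesis mY : forall G, calY G -> measurable G.
Hypothesis mL : forall k i, (k <= K)%N -> (i < N k)%N -> measurable (L k i).
Hypothesis mU : forall k i, (k <= K)%N -> (i < N k)%N -> measurable (U k i).
Hypothesis LU : forall k i, (k <= K)%N -> (i < N k)%N ->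
  disagreement pi (L k i) (U k i) <= dl k.
Hypothesis cover : forall k G, (k <= K)%N -> calY G ->
  exists2 i, (i < N k)%N & L k i `<=` G /\ G `<=` U k i.
Hypothesis N_H : forall k, (k <= K)%N -> (N k)%:R <= expR (H k).
Hypothesis HB : forall k, (k <= K)%N -> 1 + H k <= B * m%:R * lam k ^+ 2 * dl k.
Hypothesis H0 : forall k, (k <= K)%N -> 0 <= H k.
Hypothesis lam01 : forall k, (k <= K)%N -> 0 < lam k <= 1.
Hypothesis dlS : forall k, dl k.+1 = dl k / 2.
Hypothesis lamS : forall k, lam k.+1 = lam k * (2 * q).
Hypothesis dl_gt0 : 0 < dl 0%N.
Hypothesis lam_dl : lam 0%N * dl 0%N = e.
Hypothesis q01 : 0 < q < 1.
Hypothesis dlK : dl K <= 2 * e.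
Hypothesis tau01 : 0 < tau <= 1.
Hypothesis B0 : 0 <= B.

Let dlk0 k : 0 < dl k.
Proof. by elim: k => // k ih; rewrite dlS divr_gt0. Qed.

Let lam_dlk k : lam k * dl k = e * q ^+ k.
Proof.
elim: k => [|k ih]; first by rewrite lam_dl mulr1.
by rewrite lamS dlS exprSr [RHS]mulrA -ih; field.
Qed.

Let e0 : 0 < e.
Proof. by rewrite -lam_dl mulr_gt0//; have /andP[] := lam01 (leq0n K). Qed.

(* With exponent [lam k], a union bound over [expR (H k)] sets at scale [dl k]
   costs no more than the variance term [m * lam k * dl k = m * e * q ^+ k]. *)
Let cost k (y : R) : (k <= K)%N -> 0 <= y ->
  (1 + H k + y) / lam k <= m%:R * (e * q ^+ k * (B * (1 + y))).
Proof.
move=> kK y0; have /andP[l0 _] := lam01 kK.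
rewrite ler_pdivrMr// -lam_dlk.
have -> : m%:R * (lam k * dl k * (B * (1 + y))) * lam k =
  (1 + y) * (B * m%:R * lam k ^+ 2 * dl k) by ring.
rewrite mulrDl mul1r lerD//; first exact: HB.
by rewrite ler_peMr// (le_trans _ (HB kK))// lerDl H0.
Qed.

Let two_le_expR1 : (2 : R) <= expR 1.
Proof. by apply: le_trans (expR_ge1Dx 1). Qed.

(** Successive lower brackets of one set [G] are both close to [G], hence at distance at most
    [2 * dl k]. The union bound runs over all pairs of brackets of the two scales, at the exponent
    of the coarser one. *)
Let link k : (k < K)%N -> exists Y, mean_le P Y 1 /\
  forall w i j G, (i < N k)%N -> (j < N k.+1)%N -> calY G ->
    L k i `<=` G -> G `<=` U k i -> L k.+1 j `<=` G -> G `<=` U k.+1 j ->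
  `|agreement_sum (Z ^~ w) 0 m (L k.+1 j) - agreement_sum (Z ^~ w) 0 m (L k i)
     - m%:R * (agreement pi (L k.+1 j) - agreement pi (L k i))|
  <= m%:R * (e * q ^+ k * (4 + B * (3 + Y w))).
Proof.
move=> kK; have kK' := ltnW kK.
(* A pair of indices is coded by one integer through division by [N k.+1]. *)
pose A p := L k.+1 (p %% N k.+1); pose A' p := L k (p %/ N k.+1).
have lt1 p : (p < N k * N k.+1)%N -> (p %% N k.+1 < N k.+1)%N.
  by case: (N k.+1) => [|b _]; rewrite ?muln0// ltn_pmod.
have lt2 p : (p < N k * N k.+1)%N -> (p %/ N k.+1 < N k)%N.
  case: (posnP (N k.+1)) => [->|N0]; first by rewrite muln0.
  by move=> h; rewrite ltn_divLR.
have mA p : (p < N k * N k.+1)%N -> measurable (A p).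
  by move=> h; apply: mL => //; exact: lt1.
have mA' p : (p < N k * N k.+1)%N -> measurable (A' p).
  by move=> h; apply: mL => //; exact: lt2.
have Ns : 2 * (N k * N k.+1)%:R <= expR ((1 + H k) + (1 + H k.+1)).
  rewrite addrACA !expRD natrM; apply: ler_pM; rewrite ?mulr_ge0 ?ler0n//.
    apply: le_trans two_le_expR1 _; rewrite ler_peMr ?expR_ge0//.
    by rewrite (le_trans _ two_le_expR1)// ler1n.
  by apply: ler_pM; rewrite ?ler0n// N_H.
have [Y [Y1 YE]] := deviation_gap mn mA mA' (lam01 kK') Ns.
exists Y; split=> // w i j G iN jN YG LiG GUi LjG GUj.
have Y0 : 0 <= Y w by case: Y1.
have mG := mY YG.
have := YE w _ (pair_index_lt iN jN).
rewrite /A /A' modnMDl divnMDl ?(leq_ltn_trans _ jN)//.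
rewrite divn_small// addn0 modn_small// => /le_trans; apply.
have /andP[l0 _] := lam01 kK'; have /andP[l10 _] := lam01 kK.
have D : disagreement pi (L k.+1 j) (L k i) <= 2 * dl k.
  apply: le_trans (disagreement_triangle pi (mL kK jN) mG (mL kK' iN)) _.
  rewrite disagreementC; apply: (@le_trans _ _ (dl k.+1 + dl k)).
    apply: lerD.
      apply: le_trans (LU kK jN); apply: disagreement_bracket => //.
        exact: mL.
      exact: mU.
    apply: le_trans (LU kK' iN); apply: disagreement_bracket => //.
      exact: mL.
    exact: mU.
  by rewrite dlS; have := dlk0 k; lra.
have c1 := cost kK' Y0.
(* The finer entropy is paid at the coarser exponent: the factor [2 * q] between the exponents and
   the [q] left from [q ^+ k.+1] make [2 * q ^+ 2 <= 2]. *)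
have c2 : (1 + H k.+1) / lam k <= m%:R * (e * q ^+ k * (B * 2)).
  have := cost kK (lexx 0); rewrite !addr0 mulr1 => c2.
  have -> : (1 + H k.+1) / lam k = (2 * q) * ((1 + H k.+1) / lam k.+1).
    rewrite lamS; field; rewrite !gt_eqF//; by case/andP: q01.
  have q0 : 0 <= 2 * q by have /andP[] := q01; lra.
  apply: le_trans (ler_wpM2l q0 c2) _.
  have -> : 2 * q * (m%:R * (e * q ^+ k.+1 * B)) =
    q ^+ 2 * (m%:R * (e * q ^+ k * (B * 2))) by rewrite exprS; ring.
  have /andP[q_0 q_1] := q01.
  apply: ler_piMl; last by apply: exprn_ile1; exact: ltW.
  apply: mulr_ge0 => //; apply: mulr_ge0; last exact: mulr_ge0.
  by apply: mulr_ge0; [exact: ltW|apply: exprn_ge0; exact: ltW].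
have c3 : 2 * lam k * m%:R * disagreement pi (L k.+1 j) (L k i) <=
    m%:R * (e * q ^+ k * 4).
  rewrite -lam_dlk.
  have -> : m%:R * (lam k * dl k * 4) = 2 * lam k * m%:R * (2 * dl k) by ring.
  by rewrite ler_wpM2l// !mulr_ge0 ?ler0n// ltW.
have -> : (1 + H k + (1 + H k.+1) + Y w) / lam k =
    (1 + H k + Y w) / lam k + (1 + H k.+1) / lam k by ring.
have -> : m%:R * (e * q ^+ k * (4 + B * (3 + Y w))) = m%:R * (e * q ^+ k * 4) +
  (m%:R * (e * q ^+ k * (B * (1 + Y w))) + m%:R * (e * q ^+ k * (B * 2)))
      by ring.
by rewrite lerD// lerD.
Qed.

(** Lowering the exponent by the factor [tau] makes the coefficient of [disagreement pi G G0] small,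
    at the price of dividing the entropy cost by [tau]. *)
Let first_link : exists Y, mean_le P Y 1 /\
  forall w i G, (i < N 0)%N -> calY G -> L 0 i `<=` G -> G `<=` U 0 i ->
  `|agreement_sum (Z ^~ w) 0 m (L 0%N i) - agreement_sum (Z ^~ w) 0 m G0
     - m%:R * (agreement pi (L 0%N i) - agreement pi G0)|
  <= m%:R * (2 * tau * lam 0%N * disagreement pi G G0
             + e * (2 * tau + B / tau * (1 + Y w))).
Proof.
have /andP[t0 t1] := tau01; have /andP[l0 l1] := lam01 (leq0n K).
have tl01 : 0 < tau * lam 0%N <= 1 by rewrite mulr_gt0// mulr_ile1// ltW.
have Ns : 2 * (N 0%N)%:R <= expR (1 + H 0%N).
  by rewrite expRD; apply: ler_pM; rewrite ?ler0n// N_H.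
have [Y [Y1 YE]] := deviation_gap mn (fun i => @mL _ i (leq0n K))
  (fun _ _ => mG0) tl01 Ns.
exists Y; split=> // w i G iN YG LG GU.
have Y0 : 0 <= Y w by case: Y1.
apply: le_trans (YE w i iN) _.
have D : disagreement pi (L 0%N i) G0 <= dl 0%N + disagreement pi G G0.
  have mLi := mL (leq0n K) iN; have mG := mY YG.
  apply: le_trans (disagreement_triangle pi mLi mG mG0) _.
  rewrite lerD2r disagreementC; apply: le_trans (LU (leq0n K) iN).
  by apply: disagreement_bracket => //; exact: mU.
have -> : m%:R * (2 * tau * lam 0%N * disagreement pi G G0
             + e * (2 * tau + B / tau * (1 + Y w))) =
    2 * (tau * lam 0%N) * m%:R * (dl 0%N + disagreement pi G G0) +
    m%:R * (e * q ^+ 0 * (B * (1 + Y w))) / tau.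
  by rewrite -lam_dl expr0; field; rewrite gt_eqF.
apply: lerD; first by apply: ler_wpM2l => //; rewrite !mulr_ge0// ltW.
rewrite invfM [X in _ * X]mulrC [leLHS]mulrA.
by rewrite ler_wpM2r ?invr_ge0 ?(ltW t0)// cost.
Qed.

(** Inside a bracket the differences are dominated by the empirical mass of the bracket, whatever
    [G] is. Only brackets enter the union bound, and their mass is at most [2 * e]. *)
Let last_link : exists Y, mean_le P Y 1 /\
  forall w i G, (i < N K)%N -> calY G -> L K i `<=` G -> G `<=` U K i ->
  `|agreement_sum (Z ^~ w) 0 m G - agreement_sum (Z ^~ w) 0 m (L K i)
     - m%:R * (agreement pi G - agreement pi (L K i))|
  <= m%:R * (e * (8 + B * (1 + Y w))).
Proof.
have /andP[l0 l1] := lam01 (leqnn K).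
have Ns : 2 * (N K)%:R <= expR (1 + H K).
  by rewrite expRD; apply: ler_pM; rewrite ?ler0n// N_H.
have [Y [Y1 YE]] := deviation_gap_sqr mn (fun i => @mL _ i (leqnn K))
  (fun i => @mU _ i (leqnn K)) (lam01 (leqnn K)) Ns.
exists Y; split=> // w i G iN YG LG GU.
have Y0 : 0 <= Y w by case: Y1.
have mG := mY YG; have mLi := mL (leqnn K) iN; have mUi := mU (leqnn K) iN.
have D2 : disagreement pi (L K i) (U K i) <= 2 * e by apply: le_trans dlK;
    exact: LU.
have h1 : `|agreement_sum (Z ^~ w) 0 m G - agreement_sum (Z ^~ w) 0 m
    (L K i)| <=
    \sum_(0 <= j < m) gap (L K i) (U K i) (Z j w) ^+ 2.
  rewrite -sum_gap; apply: le_trans (ler_norm_sum _ _ _) _.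
  by apply: ler_sum => j _; exact: normr_gap_bracket.
have h2 : `|agreement pi G - agreement pi (L K i)| <= 2 * e.
  rewrite ler_norml lerNl opprB; apply/andP; split.
    apply: le_trans (agreement_le_disagreement pi mLi mG) _.
    by rewrite disagreementC; apply: le_trans
        (disagreement_bracket _ _ _ _ _) D2.
  apply: le_trans (agreement_le_disagreement pi mG mLi) _.
  by apply: le_trans (disagreement_bracket _ _ _ _ _) D2.
have := YE w i iN; rewrite ler_norml => /andP[_].
rewrite lerBlDr => h3.
have c := cost (leqnn K) Y0.
have c' : m%:R * (e * q ^+ K * (B * (1 + Y w))) <= m%:R * (e * (B * (1 + Y w))).
  apply: ler_wpM2l => //; apply: ler_wpM2r.
    by rewrite mulr_ge0// addr_ge0.
  apply: ler_piMr; first exact: ltW.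
  by have /andP[q0 q1] := q01; apply: exprn_ile1; exact: ltW.
have M0 : 0 <= m%:R :> R by [].
have d1 : m%:R * disagreement pi (L K i) (U K i) <= m%:R * (2 * e).
  by apply: ler_wpM2l.
have d2 : 2 * lam K * m%:R * disagreement pi (L K i) (U K i) <=
    2 * (m%:R * (2 * e)).
  rewrite -!mulrA ler_wpM2l// [leRHS]mulrA; apply: le_trans (ler_piMl _ l1) _.
    by rewrite mulr_ge0// disagreement_ge0.
  by rewrite -mulrA.
apply: le_trans (ler_normB _ _) _.
rewrite [X in _ + X]normrM (ger0_norm M0).
have d3 := ler_wpM2l M0 h2.
(* Of the four copies of [2 * e], one is the mean mass of the bracket, two its variance term with
   [lam K <= 1], and one the mean of the difference. *)
have -> : m%:R * (e * (8 + B * (1 + Y w))) =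
  4 * (m%:R * (2 * e)) + m%:R * (e * (B * (1 + Y w))) by ring.
by lra.
Qed.

Lemma chaining_bound : exists W,
  mean_le P W (2 * tau + 2 * (B / tau) + (4 + 4 * B) / (1 - q) + (8 + 2 * B)) /\
  forall w G, calY G ->
  `|agreement_sum (Z ^~ w) 0 m G - agreement_sum (Z ^~ w) 0 m G0
     - m%:R * (agreement pi G - agreement pi G0)|
  <= m%:R * (2 * tau * lam 0%N * disagreement pi G G0 + e * W w).
Proof.
have [Y0 [Y01 Y0E]] := first_link; have [Y1 [Y11 Y1E]] := last_link.
have /choice[Y YP] := fun k : 'I_K => link (ltn_ord k).
have /andP[t0 t1] := tau01; have /andP[q0 q1] := q01.
have Bt : 0 <= B / tau by rewrite divr_ge0// ltW.
(* The constants of the two end links, then their random terms and the geometrically weighted terms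
   of the inner links. *)
exists (fun w => (2 * tau + B / tau + (8 + B)) + (B / tau * Y0 w +
  (\sum_(k < K) (q ^+ k * (4 + 3 * B) + q ^+ k * B * Y k w) + B * Y1 w))).
split.
  apply: (@mean_leS _ _ _ _ _ ((2 * tau + B / tau + (8 + B)) + (B / tau * 1 +
    (\sum_(k < K) (q ^+ k * (4 + 3 * B) + q ^+ k * B * 1) + B * 1)))).
    apply: mean_leD.
      apply: mean_le_cst; apply: addr_ge0; last exact: addr_ge0.
      by apply: addr_ge0 => //; apply: mulr_ge0 => //; exact: ltW.
    apply: mean_leD; first exact: mean_leZ.
    apply: mean_leD; last exact: mean_leZ.
    apply: mean_le_sum => k; apply: mean_leD.
      apply: mean_le_cst; apply: mulr_ge0; first exact/exprn_ge0/ltW.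
      by rewrite addr_ge0// mulr_ge0.
    apply: mean_leZ; last by case: (YP k).
    by apply: mulr_ge0 => //; exact/exprn_ge0/ltW.
  have geo : \sum_(k < K) q ^+ k <= (1 - q)^-1.
    rewrite -[leRHS]mul1r ler_pdivlMr ?subr_gt0// mulrC -opprB mulNr -subrX1.
    by rewrite opprB gerBl exprn_ge0// ltW.
  have -> : \sum_(k < K) (q ^+ k * (4 + 3 * B) + q ^+ k * B * 1) =
      (4 + 4 * B) * \sum_(k < K) q ^+ k.
    by rewrite mulr_sumr; apply: eq_bigr => k _; ring.
  have h : (4 + 4 * B) * \sum_(k < K) q ^+ k <= (4 + 4 * B) / (1 - q).
    by apply: ler_wpM2l => //; rewrite addr_ge0// mulr_ge0.
  by move: (\sum_(k < K) _) (_ / (1 - q)) (B / tau) h => u v b h; lra.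
move=> w G YG.
(* A bracket of [G] is fixed at every scale; the centred process [S] is then telescoped from [G0]
   through the lower brackets to [G]. *)
have /choice[i iP] : forall k, exists i, (k <= K)%N ->
    (i < N k)%N /\ (L k i `<=` G /\ G `<=` U k i).
  move=> k; case: (leqP k K) => [kK|kK]; last by exists 0%N.
  by have [i iN LGU] := cover kK YG; exists i.
pose S A := agreement_sum (Z ^~ w) 0 m A - m%:R * agreement pi A.
have SE A A' : agreement_sum (Z ^~ w) 0 m A - agreement_sum (Z ^~ w) 0 m A'
     - m%:R * (agreement pi A - agreement pi A') = S A - S A' by rewrite /S;
         ring.
rewrite SE.
have -> : S G - S G0 = (S (L 0%N (i 0%N)) - S G0) +
    ((S (L K (i K)) - S (L 0%N (i 0%N))) + (S G - S (L K (i K)))) by ring.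
apply: le_trans (ler_normD _ _) _.
apply: le_trans (lerD (lexx _) (ler_normD _ _)) _.
have [i0N [Li0 Ui0]] := iP 0%N (leq0n K);
    have [iKN [LiK UiK]] := iP K (leqnn K).
have := Y0E w _ G i0N YG Li0 Ui0; have := Y1E w _ G iKN YG LiK UiK.
rewrite !SE => a1 a0.
have a2 : `|S (L K (i K)) - S (L 0%N (i 0%N))| <=
    m%:R * (e * \sum_(k < K) (q ^+ k * (4 + 3 * B) + q ^+ k * B * Y k w)).
  rewrite -(telescope_sumr (fun k => S (L k (i k))) (leq0n K)) big_mkord.
  apply: le_trans (ler_norm_sum _ _ _) _; rewrite !mulr_sumr;
      apply: ler_sum => k _.
  have [_ /(_ w (i k) (i k.+1) G)] := YP k.
  have [iN [LGi GUi]] := iP k (ltnW (ltn_ord k)).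
  have [iN' [LGi' GUi']] := iP k.+1 (ltn_ord k).
  move=> /(_ iN iN' YG LGi GUi LGi' GUi'); rewrite SE => /le_trans; apply.
  by rewrite -subr_ge0 (_ : _ - _ = 0)//; ring.
apply: le_trans (lerD a0 (lerD a2 a1)) _.
by rewrite -subr_ge0 (_ : _ - _ = 0)//; ring.
Qed.

End chain.
End chaining.

Lemma powR_expR (R : realType) (x a : R) : 0 < x -> x `^ a = expR (a * ln x).
Proof. by move=> x0; rewrite /powR gt_eqF. Qed.

(** * Scales and exponents of the chain *)

Section scales.
Context {R : realType}.
Variables (kappa rho x : R).
Hypothesis k1 : 1 <= kappa.
Hypothesis r0 : 0 < rho.
Hypothesis r1 : rho < 1.
Hypothesis x1 : 1 <= x.

Definition scale0 : R := x `^ (- (2 * kappa + rho - 1)^-1).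
Definition rate : R := x `^ (- (kappa / (2 * kappa + rho - 1))).
(** Chosen so that [2 * ratio] is 2 to the power [(1 + rho) / 2]: halving the scale then leaves the
    squared exponent times the scale to the power [1 + rho] unchanged. *)
Definition ratio : R := 2 `^ (- ((1 - rho) / 2)).
Definition scale (k : nat) : R := scale0 / 2 ^+ k.
Definition exponent (k : nat) : R := scale0 `^ (kappa - 1) * (2 * ratio) ^+ k.

Let x0 : 0 < x. Proof. exact: lt_le_trans x1. Qed.
Let D0 : 0 < 2 * kappa + rho - 1. Proof. by move: k1 r0; lra. Qed.
Let lnx0 : 0 <= ln x. Proof. exact: ln_ge0. Qed.
Let l20 : 0 < ln (2 : R). Proof. by apply: ln_gt0; rewrite ltr1n. Qed.

Let scale0E : scale0 = expR (- (ln x / (2 * kappa + rho - 1))).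
Proof. by rewrite /scale0 powR_expR// mulNr mulrC. Qed.

Lemma rateE : rate = scale0 `^ kappa.
Proof.
by rewrite /rate /scale0 -powRrM [kappa / _]mulrC mulNr.
Qed.

Lemma scale0_gt0 : 0 < scale0. Proof. exact: powR_gt0. Qed.

Lemma scale0_le1 : scale0 <= 1.
Proof. by rewrite scale0E -[leRHS]expR0 ler_expR oppr_le0 divr_ge0// ltW. Qed.

Lemma rate_gt0 : 0 < rate. Proof. exact: powR_gt0. Qed.

Let two_powE k : (2 : R) ^+ k = expR (k%:R * ln 2).
Proof. by rewrite expRM_natl lnK ?posrE. Qed.

Let scaleE k : scale k = expR (- (ln x / (2 * kappa + rho - 1)) - k%:R * ln 2).
Proof. by rewrite /scale scale0E two_powE expRD (expRN (k%:R * _)). Qed.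

Let two_ratioE : 2 * ratio = expR ((1 + rho) / 2 * ln 2).
Proof.
rewrite /ratio powR_expR// -[X in X * _](lnK (x := 2)) ?posrE// -expRD.
by congr expR; field.
Qed.

Let exponentE k : exponent k =
  expR (- ((kappa - 1) * (ln x / (2 * kappa + rho - 1))) +
      k%:R * ((1 + rho) / 2 * ln 2)).
Proof.
rewrite /exponent two_ratioE -expRM_natl powR_expR ?scale0_gt0// -expRD.
by rewrite scale0E expRK mulrN.
Qed.

Lemma scale_gt0 k : 0 < scale k. Proof. by rewrite scaleE expR_gt0. Qed.

Lemma scale_le1 k : scale k <= 1.
Proof.
rewrite ler_pdivrMr ?exprn_gt0// mul1r; apply: le_trans scale0_le1 _.
by rewrite exprn_ege1// ler1n.
Qed.

Lemma scaleS k : scale k.+1 = scale k / 2.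
Proof. by rewrite /scale exprSr invfM mulrA. Qed.

Lemma exponentS k : exponent k.+1 = exponent k * (2 * ratio).
Proof. by rewrite /exponent exprSr mulrA. Qed.

Lemma exponent_gt0 k : 0 < exponent k.
Proof. by rewrite exponentE expR_gt0. Qed.

Lemma exponent_scale0 : exponent 0 * scale 0 = rate.
Proof.
rewrite /exponent /scale !expr0 mulr1 divr1 rateE mulrC mulr_powRB1 ?ltW
    ?scale0_gt0//.
by move: k1; lra.
Qed.

Lemma exponent0 : exponent 0 = scale0 `^ (kappa - 1).
Proof. by rewrite /exponent expr0 mulr1. Qed.

Lemma ratio_bounds : 0 < ratio < 1.
Proof.
rewrite powR_gt0//= /ratio powR_expR// -[ltRHS]expR0 ltr_expR.
by rewrite mulNr oppr_lt0 mulr_gt0// divr_gt0//; move: r0 r1; lra.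
Qed.

(** At [k = 0] this is the equation determining [scale0]. It equates the entropy, the scale to the
    power [- rho], with the variance budget [x * exponent k ^+ 2 * scale k]. *)
Lemma scale_exponent k : x * exponent k ^+ 2 * scale k `^ (1 + rho) = 1.
Proof.
rewrite powR_expR ?scale_gt0// exponentE scaleE expRK -expRM_natl.
rewrite -[X in X * _ * _]lnK ?posrE// -!expRD -[RHS]expR0; congr expR.
by field; rewrite gt_eqF.
Qed.

(** [K] is the last index before the exponent exceeds 1. As the product of exponent and scale is
    [rate * ratio ^+ k], an exponent above 1 at [K.+1] bounds the scale at [K] by [2 * rate]. *)
Lemma last_scale : exists K, (forall k, (k <= K)%N -> exponent k <= 1) /\
  scale K <= 2 * rate.
Proof.
have ex : exists k, 1 < exponent k.+1.
  pose M := Num.bound (exponent 0)^-1; exists (M + M)%N.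
  have lM : (exponent 0)^-1 < M%:R.
    by apply: archi_boundP; rewrite invr_ge0 ltW// exponent_gt0.
  rewrite /exponent exprS addnn -mul2n exprM.
  have h2 : 1 <= 2 * ratio by rewrite two_ratioE
      -[leLHS]expR0 ler_expR mulr_ge0 1?ltW//; move: r0 r1; lra.
  (* The square is 2 to the power [1 + rho], so the even powers grow at least like powers of 2. *)
  have h4 : 2 <= (2 * ratio) ^+ 2.
    rewrite two_ratioE -expRM_natl -[leLHS](lnK (x := 2)) ?posrE// ler_expR.
    by rewrite mulrA ler_peMl ?(ltW l20)//; move: r0 r1; lra.
  have hM : M%:R <= ((2 * ratio) ^+ 2) ^+ M.
    apply: (@le_trans _ _ (2 ^+ M));
        first by rewrite -natrX ler_nat ltnW// ltn_expl.
    by rewrite lerXn2r// nnegrE// (le_trans _ h4).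
  have : 1 < exponent 0 * M%:R.
    by rewrite -ltr_pdivrMl ?exponent_gt0// mulr1.
  move/lt_le_trans; apply; rewrite exponent0.
  apply: ler_wpM2l; first exact: powR_ge0.
  by apply: le_trans hM _; rewrite ler_peMl// exprn_ge0// (le_trans _ h4).
case: (ex_minnP ex) => K eK minK; exists K; split.
  case=> [_|k kK].
    rewrite exponent0 [leRHS](_ : 1 = 1 `^ (kappa - 1)); last by rewrite powR1.
    apply: ge0_ler_powR; rewrite ?nnegrE ?subr_ge0 ?scale0_le1//.
    by rewrite ltW// scale0_gt0.
  by rewrite leNgt; apply/negP => /minK; rewrite leqNgt kK.
have e k : exponent k * scale k = rate * ratio ^+ k.
  elim: k => [|k ih]; first by rewrite exponent_scale0 mulr1.
  by rewrite exponentS scaleS exprSr [RHS]mulrA -ih; field.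
have /andP[q0 q1] := ratio_bounds.
have : scale K <= exponent K.+1 * scale K by rewrite ler_peMl ?ltW ?scale_gt0.
move/le_trans; apply; rewrite exponentS mulrAC e.
have -> : rate * ratio ^+ K * (2 * ratio) = 2 * rate * ratio ^+ K.+1.
  by rewrite exprS; ring.
apply: ler_piMr; first by rewrite mulr_ge0// ltW ?rate_gt0.
by apply: exprn_ile1; exact: ltW.
Qed.

(** This limits how much a wrong entropy exponent costs at the scales in use. *)
Lemma scale_ge k : exponent k <= 1 -> x^-1 <= scale k.
Proof.
move=> ek; apply: (@le_trans _ _ (scale k `^ (1 + rho))).
  have xn : x != 0 by rewrite gt_eqF.
  have -> : x^-1 = exponent k ^+ 2 * scale k `^ (1 + rho).
    by apply: (mulfI xn); rewrite mulfV// mulrA scale_exponent.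
  rewrite ler_piMl ?powR_ge0// exprn_ile1//.
  by rewrite ltW// exponent_gt0.
by apply: ge1r_powR; [rewrite scale_gt0 scale_le1|move: r0; lra].
Qed.

End scales.

(** * Uniform deviations over a class of bounded entropy *)

Section uniform_deviation.
Context {R : realType} {d : nat} (pi : probability (obs R d) R).
Local Notation X := (Rspace R d).

(** The bracketing number is an infimum; the added 1 in the exponent makes the bound strict, so that
    some actual cover satisfies it. *)
Lemma complexity_cover (A rho del : R) (calY : set (set X)) :
  complexity_bound (marginal pi) A rho calY -> 0 < del <= 1 ->
  exists NLU : nat * (nat -> set X) * (nat -> set X),
  let N := NLU.1.1 in let L := NLU.1.2 in let U := NLU.2 in
  [/\ N%:R <= expR (1 + A * del `^ (- rho)),
      forall i, (i < N)%N -> [/\ measurable (L i), measurable (U i) &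
        disagreement pi (L i) (U i) <= del] &
      forall G, calY G -> exists2 i, (i < N)%N & L i `<=` G /\ G `<=` U i].
Proof.
move=> cY del01; have := cY del del01; rewrite /bracketing_entropy.
set r := A * _; set b := bracketing_number _ _ _ => br.
have blt : (b < (expR (1 + r))%:E)%E.
  rewrite ltNge; apply/negP => rb.
  have b0 : (0 <= b)%E by apply: le_trans rb; rewrite lee_fin expR_ge0.
  have : (lne (expR (1 + r))%:E <= lne b)%E.
    by rewrite lee_lne// in_itv/= ?leey ?andbT// lee_fin expR_ge0.
  rewrite lne_EFin ?expR_gt0// expRK => /le_trans/(_ br).
  by rewrite lee_fin; lra.
have [_ [N [L [U [LU cov]]] <-]] := ereal_inf_lt blt.
rewrite lte_fin => NR.
pose f (V : 'I_N -> set X) (i : nat) := if insub i is Some j then V j else set0.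
have fE V (i : 'I_N) : f V i = V i by rewrite /f valK.
exists (N, f L, f U) => /=; split; first exact: ltW.
- move=> i iN; rewrite (fE L (Ordinal iN)) (fE U (Ordinal iN)).
  have [mL mU D] := LU (Ordinal iN); split=> //.
  by rewrite -lee_fin disagreementE.
- move=> G /cov[i [LG GU]]; exists i => //.
  by rewrite !fE.
Qed.

Context dO (Omega : measurableType dO) (P : probability Omega R)
  (Z : nat -> {RV P >-> obs R d}) (n : nat).
Hypothesis iidZ : iid_sample pi Z n.

(** The constant [B] of the chain: [2 + A * C1] bounds [1 + H k] in units of the scale to the power
    [- rho], and the factor 2 passes from [n] to [m]. *)
Definition chain_cost (A C1 : R) : R := 2 * (2 + A * C1).

Definition deviation_cst (A C1 rmax tau : R) : R :=
  let B := chain_cost A C1 in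
  2 * tau + 2 * (B / tau) + (4 + 4 * B) / (1 - ratio rmax) + (8 + 2 * B).

(** The scales are tuned to [rho] while the class has entropy exponent [rho']. All scales in use are
    at least [n%:R^-1], so the mismatch costs at most [n] to the power [rho' - rho], bounded by
    [C1]. *)
Lemma uniform_deviation (kappa rho rho' rmax A C1 tau : R) (m : nat)
    (calY : set (set X)) (G0 : set X) :
  1 <= kappa -> 0 < rho -> rho <= rmax -> rmax < 1 -> rho <= rho' -> 0 < A ->
  0 < tau <= 1 -> (0 < n)%N -> (m <= n)%N -> (n <= 2 * m)%N ->
  n%:R `^ (rho' - rho) <= C1 ->
  complexity_bound (marginal pi) A rho' calY ->
  (forall G, calY G -> measurable G) -> measurable G0 ->
  exists W, mean_le P W (deviation_cst A C1 rmax tau) /\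
  forall w G, calY G ->
  `|agreement_sum (Z ^~ w) 0 m G - agreement_sum (Z ^~ w) 0 m G0
     - m%:R * (agreement pi G - agreement pi G0)|
  <= m%:R * (2 * tau * scale0 kappa rho n%:R `^ (kappa - 1)
                * disagreement pi G G0 + rate kappa rho n%:R * W w).
Proof.
move=> k1 r0 rm rm1 rr' A0 t01 n0 mn nm nC1 cY mY mG0.
have r1 : rho < 1 by exact: le_lt_trans rm rm1.
have x1 : 1 <= n%:R :> R by rewrite ler1n.
have C11 : 1 <= C1.
  apply: le_trans nC1; rewrite -[leLHS](powRr0 n%:R); apply: ler_powR => //.
  by rewrite subr_ge0.
have [K [eK sK]] := last_scale k1 r0 r1 x1.
pose dl := scale kappa rho n%:R; pose lam := exponent kappa rho n%:R.
have dl01 k : 0 < dl k <= 1.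
  by rewrite scale_gt0//= scale_le1.
have /choice[NLU NLUP] := fun k => complexity_cover cY (dl01 k).
pose N k := (NLU k).1.1; pose L k := (NLU k).1.2; pose U k := (NLU k).2.
pose H k := 1 + A * dl k `^ (- rho').
have H0 k : 0 <= H k by rewrite addr_ge0// mulr_ge0 ?powR_ge0// ltW.
pose B := chain_cost A C1.
have B0 : 0 <= B.
  by rewrite /B /chain_cost mulr_ge0// addr_ge0// mulr_ge0// ltW//
      (lt_le_trans _ C11).
have HB k : (k <= K)%N -> 1 + H k <= B * m%:R * lam k ^+ 2 * dl k.
  move=> kK; have /andP[d0 d1] := dl01 k.
  have inv : dl k `^ (- rho) = n%:R * lam k ^+ 2 * dl k.
    rewrite powRN; apply: (mulIf (lt0r_neq0 (powR_gt0 rho d0))).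
    have := scale_exponent k1 r0 x1 k.
    rewrite powRD; last by rewrite (gt_eqF d0) implybT.
    rewrite powRr1 1?ltW// => E.
    rewrite mulVf ?gt_eqF ?powR_gt0//; apply: (etrans (esym E)).
    rewrite /lam /dl. ring.
  have g1 : 1 <= dl k `^ (- rho).
    rewrite -[leLHS](powRr0 (dl k)); apply: ger_powR; first exact: dl01.
    by rewrite oppr_le0 ltW.
  have gC : dl k `^ (- rho') <= C1 * dl k `^ (- rho).
    have -> : - rho' = - (rho' - rho) + - rho by ring.
    rewrite powRD ?(gt_eqF d0) ?implybT// ler_wpM2r ?powR_ge0//.
    have t0 : 0 <= rho' - rho by rewrite subr_ge0.
    have dn : n%:R^-1 <= dl k.
      by apply: (scale_ge k1 r0 x1); exact: eK.
    have dnt : (n%:R `^ (rho' - rho))^-1 <= dl k `^ (rho' - rho).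
      rewrite -powRN -mulN1r powRrM powR_inv1 ?ler0n//.
      by apply: ge0_ler_powR; rewrite ?nnegrE ?invr_ge0 ?ler0n// ltW.
    apply: le_trans nC1; rewrite powRN -[leRHS]invrK lef_pV2//.
      by rewrite posrE powR_gt0.
    by rewrite posrE invr_gt0 powR_gt0// ltr0n.
  have n2m : n%:R <= 2 * m%:R :> R by rewrite -natrM ler_nat.
  have l0 : 0 <= lam k ^+ 2 * dl k by rewrite mulr_ge0 ?sqr_ge0// ltW.
  apply: (@le_trans _ _ ((2 + A * C1) * dl k `^ (- rho))).
    rewrite /H addrA mulrDl; apply: lerD;
        first by rewrite -[leLHS]mulr1 ler_wpM2l.
    by rewrite -mulrA ler_wpM2l// ltW.
  rewrite inv /B /chain_cost.
  have c0 : 0 <= 2 + A * C1 by rewrite addr_ge0// mulr_ge0// ltW//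
      (lt_le_trans _ C11).
  have := ler_wpM2r l0 n2m => /(ler_wpM2l c0); rewrite !mulrA => /le_trans;
      apply.
  by rewrite -subr_ge0 (_ : _ - _ = 0)//; ring.
have lam01 k : (k <= K)%N -> 0 < lam k <= 1.
  by move=> kK; rewrite eK// andbT; exact: exponent_gt0.
have d00 : 0 < dl 0%N by have /andP[] := dl01 0%N.
have ld : lam 0%N * dl 0%N = rate kappa rho n%:R by exact: exponent_scale0.
have [W [W1 WE]] := chaining_bound iidZ (L := L) (U := U) (lam := lam)
    (q := ratio rho)
  mn mG0 mY (fun k i kK iN => let: And3 a _ _ :=
      (let: And3 _ b _ := NLUP k in b i iN) in a)
  (fun k i kK iN => let: And3 _ a _ :=
      (let: And3 _ b _ := NLUP k in b i iN) in a)
  (fun k i kK iN => let: And3 _ _ a :=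
      (let: And3 _ b _ := NLUP k in b i iN) in a)
  (fun k G kK YG => (let: And3 _ _ c := NLUP k in c G YG))
  (fun k kK => (let: And3 a _ _ := NLUP k in a))
  HB (fun k _ => H0 k)
  lam01 (scaleS kappa rho n%:R) (exponentS kappa rho n%:R) d00 ld
  (ratio_bounds r0 r1) sK t01 B0.
exists W; split; last by move=> w G YG; have := WE w G YG;
    rewrite /lam exponent0.
apply: mean_leS W1 _.
(* [ratio] increases with [rho]; its value at [rmax] makes the constant uniform in [rho]. *)
rewrite /deviation_cst -/B lerD2r lerD2l.
apply: ler_wpM2l; first by rewrite addr_ge0// mulr_ge0.
have /andP[q0 q1] := ratio_bounds r0 r1.
have /andP[q0' q1'] := ratio_bounds (lt_le_trans r0 rm) rm1.
rewrite lef_pV2 ?posrE ?subr_gt0// lerD2l lerN2 /ratio.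
by apply: ler_powR; [rewrite ler1n|lra].
Qed.

End uniform_deviation.

(** * Selection and aggregation *)

(** Replacing the smaller of [u] and [v] by the larger bounds the product by one of the two
    terms. *)
Lemma powR_young (R : realType) (kappa u v : R) : 1 <= kappa -> 0 <= u -> 0 <=
    v ->
  u `^ (kappa - 1) * v <= u `^ kappa + v `^ kappa.
Proof.
move=> k1 u0 v0; have k0 : 0 < kappa by lra.
have k10 : 0 <= kappa - 1 by lra.
have [vu|/ltW uv] := leP v u.
  apply: (@le_trans _ _ (u `^ kappa)); last by rewrite lerDl powR_ge0.
  by rewrite -(mulr_powRB1 u0 k0) mulrC ler_wpM2r// powR_ge0.
apply: (@le_trans _ _ (v `^ kappa)); last by rewrite lerDr powR_ge0.
rewrite -(mulr_powRB1 v0 k0) mulrC ler_wpM2l//.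
by apply: ge0_ler_powR.
Qed.

(* Jensen's inequality for [ln], through [ln x <= x - 1]. *)
Lemma gibbs_mean (R : realType) (M : nat) (c : 'I_M -> R) (j0 : 'I_M) :
  \sum_(j < M) expR (- c j) / (\sum_(k < M) expR (- c k)) * c j
    <= c j0 + ln M%:R.
Proof.
set W := \sum_(k < M) expR (- c k).
have M0 : 0 < M%:R :> R by rewrite ltr0n (leq_ltn_trans _ (ltn_ord j0)).
have Wj : expR (- c j0) <= W.
  by rewrite /W (bigD1 j0)//= lerDl sumr_ge0// => k _; exact: expR_ge0.
have W0 : 0 < W by apply: lt_le_trans Wj; exact: expR_gt0.
have w1 : \sum_(j < M) expR (- c j) / W =
    1 by rewrite -mulr_suml divff// gt_eqF.
have lnWj : - c j0 <= ln W.
  by rewrite -(expRK (- c j0)) ler_ln ?posrE ?expR_gt0.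
(* [c j + ln W] is minus the logarithm of the [j]-th weight, so this sum is minus the relative
   entropy of the weights to the uniform law. *)
suff : \sum_(j < M) expR (- c j) / W * (c j + ln W - ln M%:R) <= 0.
  under eq_bigr do rewrite -addrA mulrDr.
  by rewrite big_split/= -mulr_suml w1 mul1r; lra.
apply: (@le_trans _ _ (\sum_(j < M) (M%:R^-1 - expR (- c j) / W))).
  apply: ler_sum => j _; set w := expR (- c j) / W.
  have w0 : 0 < w by rewrite divr_gt0// expR_gt0.
  have -> : c j + ln W - ln M%:R = ln (w^-1 / M%:R).
    by rewrite ln_div ?posrE ?invr_gt0// invf_div ln_div ?posrE
        ?expR_gt0// expRK; ring.
  have h : ln (w^-1 / M%:R) <= w^-1 / M%:R - 1.
    have := le_ln1Dx (x := w^-1 / M%:R - 1).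
    rewrite addrCA subrr addr0; apply.
    by rewrite ltrBrDl addrN divr_gt0// invr_gt0.
  apply: le_trans (ler_wpM2l (ltW w0) h) _.
  by rewrite mulrBr mulr1 mulrA divff ?gt_eqF// mul1r.
rewrite sumrB w1 sumr_const card_ord -[M%:R^-1 *+ M]mulr_natl divff ?subrr//.
by rewrite gt_eqF.
Qed.

Section empirical.
Context {R : realType} {d : nat}.
Local Notation X := (Rspace R d).

Lemma agreement_classifier (y : bool) (A : set X) (x : X) :
  (if lab R y * set_classifier R A x <= 0 then 1 else 0) =
  (1 + lab R y) / 2 - lab R y * \1_A x :> R.
Proof.
rewrite /set_classifier /lab; case: (indic_bool A x) => ->; case: y.
- by rewrite ifT; lra.
- by rewrite ifF; [lra|apply/negbTE; rewrite -ltNge; lra].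
- by rewrite ifF; [lra|apply/negbTE; rewrite -ltNge; lra].
- by rewrite ifT; lra.
Qed.

Lemma emp_riskE (z : nat -> obs R d) (m : nat) (A : set X) :
  emp_risk [tuple z i | i < m] (set_classifier R A) =
  m%:R^-1 * (\sum_(0 <= j < m) (1 + lab R (z j).2) / 2 - agreement_sum z 0 m A).
Proof.
rewrite /emp_risk /agreement_sum -sumrB big_mkord; congr (_ * _).
by apply: eq_bigr => i _; rewrite tnth_mktuple agreement_classifier.
Qed.

(** On classifiers with values 1 and -1 the hinge loss is twice the 0-1 loss, so the exponential
    weights depend on empirical risks only. *)
Lemma hinge_classifier (y : bool) (A : set X) (x : X) :
  Num.max 0 (1 - lab R y * set_classifier R A x) =
  1 + lab R y - 2 * (lab R y * \1_A x) :> R.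
Proof.
rewrite /set_classifier /lab; case: (indic_bool A x) => ->; case: y.
- by rewrite max_r; lra.
- by rewrite max_l; lra.
- by rewrite max_l; lra.
- by rewrite max_r; lra.
Qed.

Lemma d_Delta_eE (z : nat -> obs R d) (m : nat) (A B : set X) :
  d_Delta_e [tuple z i | i < m] A B =
  (m%:R^-1 * \sum_(0 <= j < m) gap A B (z j) ^+ 2)%:E.
Proof.
rewrite /d_Delta_e big_mkord; congr (_ * _)%:E; apply: eq_bigr => i _.
by rewrite tnth_mktuple gap_sqr_indic.
Qed.

End empirical.

Section selection.
Context {R : realType} {d : nat} (pi : probability (obs R d) R)
  (eta : Rspace R d -> R).
Local Notation X := (Rspace R d).
Local Notation G0 := (bayes_set eta).
Variables (kappa c rho tau : R) (n : nat).
Hypothesis eta_reg : regression_function pi eta.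
Hypothesis k1 : 1 <= kappa.
Hypothesis c0 : 0 < c.
Hypothesis mrg : margin_assumption kappa c pi eta.
Hypothesis r0 : 0 < rho.
Hypothesis tau01 : 0 < tau <= 1.
Hypothesis tau_margin : 2 * tau * (c / 2) `^ kappa <= 2^-1.
Hypothesis n_gt0 : (0 < n)%N.
Local Notation e := (rate kappa rho n%:R).
Local Notation dl := (scale0 kappa rho n%:R).
Local Notation excess := (set_excess pi eta).

Let mG0 := measurable_bayes_set eta_reg.
Let x1 : 1 <= n%:R :> R. Proof. by rewrite ler1n. Qed.
Let e0 : 0 < e. Proof. exact: rate_gt0. Qed.

(** Young's inequality splits the product into [e] and a power of the disagreement, which the margin
    assumption bounds by the excess risk; [tau_margin] keeps its coefficient at most 1/2. *)
Lemma relative_deviation (A : set X) (r W : R) : measurable A ->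
  `|r - excess A| <= 2 * tau * dl `^ (kappa - 1) * disagreement pi A G0 +
      e * W ->
  `|r - excess A| <= excess A / 2 + e * (2 * tau + W).
Proof.
move=> mA /le_trans; apply; have /andP[t0 _] := tau01.
have dl0 : 0 <= dl by apply: ltW; exact: scale0_gt0.
have h1 := powR_young k1 dl0 (disagreement_ge0 pi A G0).
have h2 := margin_disagreement eta_reg k1 c0 mrg mA.
rewrite -rateE in h1.
have h3 : 2 * tau * (dl `^ (kappa - 1) * disagreement pi A G0) <=
    2 * tau * (e + (c / 2) `^ kappa * excess A).
  apply: ler_wpM2l; first by rewrite mulr_ge0// ltW.
  by apply: le_trans h1 _; rewrite lerD2l.
have h4 := ler_wpM2r (set_excess_ge0 eta_reg mA) tau_margin.
move: h3 h4; rewrite -(mulrA (2 * tau));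
    move: (_ * disagreement _ _ _) (excess A) => u v.
move: (_ `^ kappa) => b; lra.
Qed.

Definition emp_excess (z : nat -> obs R d) (k q : nat) (A : set X) : R :=
  (q - k)%:R^-1 * (agreement_sum z k q G0 - agreement_sum z k q A).

Lemma emp_excess_disagreement (z : nat -> obs R d) m (A : set X) :
  emp_excess z 0 m A <= m%:R^-1 * \sum_(0 <= j < m) gap G0 A (z j) ^+ 2.
Proof.
rewrite /emp_excess subn0 -sum_gap ler_wpM2l ?invr_ge0//.
by apply: ler_sum => j _; exact: gap_le_sqr.
Qed.

Lemma normr_emp_excess (z : nat -> obs R d) k q (A : set X) (b : R) :
  (k < q)%N ->
  `|agreement_sum z k q A - agreement_sum z k q G0
     - (q - k)%:R * (agreement pi A - agreement pi G0)| <= (q - k)%:R * b ->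
  `|emp_excess z k q A - excess A| <= b.
Proof.
move=> kq; have qk : 0 < (q - k)%:R :> R by rewrite ltr0n subn_gt0.
move=> h; rewrite -(ler_pM2l qk); apply: le_trans h.
rewrite -{1}(gtr0_norm qk) -normrM -normrN mulrBr mulVKf ?gt_eqF// /set_excess.
by rewrite -subr_ge0 (_ : _ - _ = 0)//; apply/eqP; rewrite subr_eq0;
  apply/eqP; congr (`| _ |); ring.
Qed.

Context dO (Omega : measurableType dO) (P : probability Omega R)
  (Z : nat -> {RV P >-> obs R d}).
Hypothesis iidZ : iid_sample pi Z n.
Local Notation prefix := (prefix Z).

(** The minimizer does no worse empirically than a net element near the Bayes set, and its own
    excess is at most twice its empirical excess up to the deviation term. Both deviations hold on
    the union of all possible nets, so a random net is allowed. *)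
Lemma erm_excess (rho' rmax A C1 E eps : R) (m : nat)
    (calG : set (set X)) (net : m.-tuple (obs R d) -> set (set X))
    (Ghat : m.-tuple (obs R d) -> set X) :
  rho <= rmax -> rmax < 1 -> rho <= rho' -> 0 < A -> (0 < m)%N ->
  (m <= n)%N -> (n <= 2 * m)%N -> n%:R `^ (rho' - rho) <= C1 ->
  eps <= E * e -> calG G0 ->
  complexity_bound (marginal pi) A rho'
    (\bigcup_(D in [set: m.-tuple (obs R d)]) net D) ->
  (forall D G, net D G -> measurable G) ->
  ((forall D, eps_net (d_Delta (marginal pi)) eps calG (net D)) \/
   (forall D, eps_net (d_Delta_e D) eps calG (net D))) ->
  (forall D, net D (Ghat D) /\ forall G, net D G ->
     emp_risk D (set_classifier R (Ghat D)) <= emp_risk D (set_classifier R G))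
         ->
  exists W, mean_le P W (deviation_cst A C1 rmax tau) /\
    forall w, excess (Ghat (prefix m w)) <= e * (3 * E + 8 * tau + 4 * W w).
Proof.
move=> rm rm1 rr' A0 m0 mn nm nC1 epsE GG0 cnet mnet isnet erm.
have /andP[t0 t1] := tau01.
have mY G : (\bigcup_(D in [set: m.-tuple (obs R d)]) net D) G -> measurable G.
  by case=> D _; exact: mnet.
have [W [W1 WE]] := uniform_deviation iidZ k1 r0 rm rm1 rr' A0 tau01 n_gt0 mn nm
  nC1 cnet mY mG0.
exists W; split=> // w; set D := prefix m w; set G := Ghat D.
have W0 : 0 <= W w by case: W1.
have dev G' : net D G' -> `|emp_excess (Z ^~ w) 0 m G' - excess G'| <=
    excess G' / 2 + e * (2 * tau + W w).
  move=> nG'; apply: relative_deviation; first exact: mnet nG'.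
  apply: normr_emp_excess => //; rewrite subn0.
  by apply: WE; exists D.
have [nG ermG] := erm D.
have ermE G' : net D G' -> emp_excess (Z ^~ w) 0 m G <=
    emp_excess (Z ^~ w) 0 m G'.
  move=> /ermG; rewrite !(emp_riskE (Z ^~ w)) /emp_excess subn0 -/D -/G.
  by rewrite !ler_pM2l ?invr_gt0 ?ltr0n// !lerD2l.
have E0 : 0 <= e * (2 * tau + W w).
  apply: mulr_ge0; first exact: ltW.
  by apply: addr_ge0 => //; apply: mulr_ge0 => //; exact: ltW.
(* Some distance is at most [eps]. The sign lets the empirical case, which yields [eps], share the
   bound [3 / 2 * eps]. *)
have eps0 : 0 <= eps.
  case: isnet => /(_ D _ GG0)[G' _]; rewrite -lee_fin; apply: le_trans.
    rewrite /d_Delta; exact: measure_ge0.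
  by rewrite lee_fin; apply: mulr_ge0; rewrite ?invr_ge0//; exact: sumr_ge0.
have [G' nG' rG'] : exists2 G', net D G' &
    emp_excess (Z ^~ w) 0 m G' <= 3 / 2 * eps + e * (2 * tau + W w).
  (* For [d_Delta] the excess is at most the distance and a deviation bound transfers it to the
     sample; for [d_Delta_e] the empirical excess is at most the empirical distance directly. *)
  case: isnet => /(_ D _ GG0)[G' nG'].
    have mG' := mnet _ _ nG'; rewrite -disagreementE// lee_fin => dis.
    exists G' => //; have := dev G' nG'; rewrite ler_norml => /andP[_].
    have := set_excess_le_disagreement eta_reg mG'; rewrite disagreementC.
    move: (emp_excess _ _ _ _) (excess G') (disagreement _ _ _) dis => u v x;
        lra.
  rewrite (d_Delta_eE (Z ^~ w)) lee_fin => dis; exists G' => //.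
  apply: le_trans (emp_excess_disagreement _ _ _) _; apply: le_trans dis _; lra.
have := dev G nG; rewrite ler_norml => /andP[+ _].
have := ermE G' nG'.
have -> : e * (3 * E + 8 * tau + 4 * W w) =
  3 * (E * e) + 4 * (e * (2 * tau + W w)) by ring.
move: (emp_excess _ _ _ G) (emp_excess _ _ _ G') (e * _) (E * _) (excess G)
  rG' epsE => u v x y t; lra.
Qed.

(** The candidates are functions of the first subsample, kept as a prefix while the second one is
    averaged. With finitely many candidates no chaining occurs: one exponent, [tau] times that of
    the coarsest scale, suffices. *)
Lemma selection_deviation (m M : nat)
    (Ghat : nat -> m.-tuple (obs R d) -> set X)
    (C2 s : R) : (m < n)%N ->
  (forall j, measurable [set p : m.-tuple (obs R d) * X | Ghat j p.1 p.2]) ->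
  2 * M%:R <= expR s -> 1 <= s -> s <=
      C2 * (n - m)%:R * dl `^ (2 * kappa - 1) ->
  exists Y, mean_le P Y 1 /\ forall w j, (j < M)%N ->
    `|emp_excess (Z ^~ w) m n (Ghat j (prefix m w)) - excess
        (Ghat j (prefix m w))|
    <= excess (Ghat j (prefix m w)) / 2
       + e * (2 * tau + C2 / tau * (1 + Y w)).
Proof.
move=> mn mS Ms s1 sC2; have /andP[t0 t1] := tau01.
have mGh j t : measurable (Ghat j t).
  have -> : Ghat j t = (fun x => (t, x)) @^-1`
      [set p : m.-tuple (obs R d) * X | Ghat j p.1 p.2] by [].
  by rewrite -[X in measurable X]setTI; exact: measurable_pair1.
pose g (j : 'I_M) (z : m.-tuple (obs R d) * obs R d) := gap (Ghat j z.1) G0 z.2.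
have mg j : measurable_fun setT (g j).
  apply: measurable_funM.
    exact: (measurableT_comp (@measurable_lab R d) measurable_snd).
  have m21 : measurable_fun setT
      (fun z : m.-tuple (obs R d) * obs R d => z.2.1).
    exact: (measurableT_comp measurable_fst measurable_snd).
  apply: measurable_funB; last first.
    have h : measurable_fun setT (\1_G0 : X -> R) by exact: measurable_indic.
    exact: (measurableT_comp h m21).
  have h : measurable_fun setT
      (\1_[set p : m.-tuple (obs R d) * X | Ghat j p.1 p.2] : _ -> R).
    exact: measurable_indic.
  have m11 : measurable_fun setT
      (fun z : m.-tuple (obs R d) * obs R d => (z.1, z.2.1)).
    by apply/measurable_fun_pair.
  have := measurableT_comp h m11; apply: eq_measurable_fun => z _ /=.
  rewrite /gap !indicE; suff -> : (z.2.1 \in Ghat j z.1) =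
    ((z.1, z.2.1) \in [set p | Ghat j p.1 p.2]) by [].
  by apply/idP/idP; rewrite !inE.
have g1 j z : `|g j z| <= 1 by exact: normr_gap.
have dl0 : 0 < dl := scale0_gt0 kappa rho x1.
have lam01 : 0 < tau * dl `^ (kappa - 1) <= 1.
  apply/andP; split; first by rewrite mulr_gt0// powR_gt0.
  apply: mulr_ile1 => //; first exact: ltW; first exact: powR_ge0.
  rewrite [leRHS](_ : 1 = 1 `^ (kappa - 1)); last by rewrite powR1.
  apply: ge0_ler_powR; rewrite ?nnegrE ?subr_ge0 ?(ltW dl0)//.
  exact: scale0_le1.
have mnn : (m <= n <= n)%N by rewrite ltnW//=.
have [Y [Y1 YE]] := deviation iidZ mnn mg g1 lam01 Ms.
exists Y; split=> // w j jM.
have Y0 : 0 <= Y w by case: Y1.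
apply: relative_deviation => //; apply: normr_emp_excess => //.
have := YE w (Ordinal jM); rewrite /g /= sum_gap integral_gap//.
move/le_trans; apply; rewrite mulrDr; apply: lerD.
  by rewrite -subr_ge0 (_ : _ - _ = 0)//; rewrite /disagreement; ring.
rewrite ler_pdivrMr ?(andP lam01).1//.
have -> : (n - m)%:R * (e * (C2 / tau * (1 + Y w))) *
    (tau * dl `^ (kappa - 1)) =
    C2 * (n - m)%:R * (e * dl `^ (kappa - 1)) * (1 + Y w).
  by field; rewrite gt_eqF.
(* This is the power of [dl] in the hypothesis on [s], which thus pays for the logarithm of the
   number of candidates. *)
have -> : e * dl `^ (kappa - 1) = dl `^ (2 * kappa - 1).
  by rewrite rateE -powRD ?(gt_eqF dl0) ?implybT//; congr (_ `^ _); ring.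
rewrite mulrDr mulr1 lerD// ler_peMl//.
exact: le_trans sC2.
Qed.

End selection.

(** * Exponential weights and the vote *)

Section aggregation.
Context {R : realType} {d : nat} (pi : probability (obs R d) R)
  (eta : Rspace R d -> R).
Local Notation X := (Rspace R d).
Hypothesis eta_reg : regression_function pi eta.
Variables (a : R) (N : nat -> nat)
  (Ghat : forall m, nat -> m.-tuple (obs R d) -> set X) (n : nat).
Local Notation l := (size_l a n).
Local Notation m := (size_m a n).
Local Notation M := (N m).+1.
Local Notation excess := (set_excess pi eta).
Hypothesis mGhat : forall k j D, measurable (@Ghat k j D).

Lemma weight_ge0 z j : 0 <= weight a N Ghat n z j.
Proof.
by rewrite divr_ge0 ?expR_ge0// sumr_ge0// => k _; exact: expR_ge0.
Qed.

Lemma weight_sum1 z : \sum_(j < M) weight a N Ghat n z j = 1.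
Proof.
rewrite -mulr_suml divff// gt_eqF// big_ord_recl ltr_pwDl ?expR_gt0//.
by rewrite sumr_ge0// => k _; exact: expR_ge0.
Qed.

Lemma measurable_aggregate z :
  measurable [set x | 0 <= aggregate a N Ghat n z x].
Proof.
have mf : measurable_fun setT (aggregate a N Ghat n z).
  apply: measurable_sum => j; apply: measurable_funM => //.
  apply: measurable_funB => //; apply: measurable_funM => //.
rewrite (_ : [set x | _] = aggregate a N Ghat n z @^-1` `[0, +oo[).
  by rewrite -[X in measurable X]setTI; exact: mf.
by apply/seteqP; split => x; rewrite /= in_itv/= andbT.
Qed.

Lemma aggregate_excess_ge0 z :
  0 <= excess_risk pi eta (aggregate a N Ghat n z).
Proof.
have mA := measurable_aggregate z.
by rewrite excess_riskE// set_excess_ge0.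
Qed.

Lemma aggregate_excess_le1 z :
  excess_risk pi eta (aggregate a N Ghat n z) <= 1.
Proof.
have mA := measurable_aggregate z; rewrite excess_riskE//.
apply: le_trans (set_excess_le_disagreement eta_reg mA) _.
by apply: disagreement_le1 => //; exact: (measurable_bayes_set eta_reg).
Qed.

(** Up to a constant common to all candidates, [l] times the hinge risk is [2 * l] times the
    empirical excess; Gibbs' inequality is divided by [2 * l]. *)
Lemma weighted_emp_excess z (j0 : 'I_M) : (0 < l)%N -> (l <= n)%N ->
  \sum_(j < M) weight a N Ghat n z j
    * emp_excess eta z m n (Ghat j [tuple z i | i < m])
  <= emp_excess eta z m n (Ghat j0 [tuple z i | i < m])
     + ln M%:R / (2 * l%:R).
Proof.
move=> l0 ln_; have nm : (n - m)%N = l by rewrite /size_m subKn.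
have l0R : 0 < l%:R :> R by rewrite ltr0n.
pose A j := Ghat j [tuple z i | i < m].
pose K := \sum_(m <= i < n) (1 + lab R (z i).2).
pose c j := K - 2 * agreement_sum z m n (A j).
have cE j : l%:R * hinge_risk a n z (fhat a Ghat n z j) = c j.
  rewrite /hinge_risk mulVKf ?gt_eqF// /c /K /agreement_sum mulr_sumr -sumrB.
  by apply: eq_bigr => i _; exact: hinge_classifier.
have wE j : weight a N Ghat n z j = expR (- c j) / \sum_(k < M) expR (- c k).
  by rewrite /weight cE; congr (_ / _); apply: eq_bigr => k _; rewrite cE.
have w1 := weight_sum1 z.
have := gibbs_mean (fun j : 'I_M => c j) j0.
under eq_bigr do rewrite -wE.
have -> : \sum_(j < M) weight a N Ghat n z j * c j =
    K - 2 * agreement_sum z m n (bayes_set eta) + 2 * l%:R *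
    \sum_(j < M) weight a N Ghat n z j * emp_excess eta z m n (A j).
  transitivity (\sum_(j < M) (weight a N Ghat n z j *
      (K - 2 * agreement_sum z m n (bayes_set eta)) + 2 * l%:R *
      (weight a N Ghat n z j * emp_excess eta z m n (A j)))).
    apply: eq_bigr => j _; rewrite /emp_excess nm /c; field.
    by rewrite gt_eqF.
  by rewrite big_split/= -mulr_suml w1 mul1r -mulr_sumr.
have -> : c j0 = K - 2 * agreement_sum z m n (bayes_set eta) +
    2 * l%:R * emp_excess eta z m n (A j0).
  by rewrite /emp_excess nm /c; field; rewrite gt_eqF.
have l2 : 0 < 2 * l%:R :> R by rewrite mulr_gt0.
move: (\sum_(j < M) _) (emp_excess _ _ _ _ _) (K - _) => u v k h.
rewrite -(ler_pM2l l2) mulrDr [2 * l%:R * (_ / _)]mulrC divfK ?gt_eqF//.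
by move: h; move: (2 * l%:R * u) (2 * l%:R * v) (ln _) => x y t; lra.
Qed.

(** The vote costs a factor 2, passing from excess to empirical excess another 2 and [2 * D], and
    returning to the excess of [j0] a factor 3/2 and [D]: hence 6 and 8. *)
Lemma aggregate_excess z (j0 : 'I_M) (D : R) : (0 < l)%N -> (l <= n)%N ->
  (forall j, (j < M)%N ->
    `|emp_excess eta z m n (Ghat j [tuple z i | i < m])
      - excess (Ghat j [tuple z i | i < m])|
    <= excess (Ghat j [tuple z i | i < m]) / 2 + D) ->
  excess_risk pi eta (aggregate a N Ghat n z) <=
  6 * excess (Ghat j0 [tuple z i | i < m]) + 8 * D + 2 * (ln M%:R / l%:R).
Proof.
move=> l0 ln_ dev.
have w0 := weight_ge0 z; have w1 := weight_sum1 z.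
have := excess_weighted_vote eta_reg
    (A := fun j : 'I_M => Ghat j [tuple z i | i < m])
  (fun j : 'I_M => w0 j) w1 (fun j => mGhat _ _).
move/le_trans; apply.
have h1 : \sum_(j < M) weight a N Ghat n z j * excess
    (Ghat j [tuple z i | i < m])
    <= 2 * (\sum_(j < M) weight a N Ghat n z j *
         emp_excess eta z m n (Ghat j [tuple z i | i < m])) + 2 * D.
  apply: (@le_trans _ _ (\sum_(j < M) (weight a N Ghat n z j * (2 * D) + 2 *
      (weight a N Ghat n z j * emp_excess eta z m n
          (Ghat j [tuple z i | i < m]))))); last first.
    by rewrite big_split/= -mulr_suml w1 mul1r -mulr_sumr addrC.
  apply: ler_sum => j _.
  have := dev j (ltn_ord j); rewrite ler_norml => /andP[+ _].
  move: (emp_excess _ _ _ _ _) (excess _) (w0 j) => u v.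
  move: (weight _ _ _ _ _ _) => w w_0 h.
  rewrite (_ : _ + _ = w * (2 * u + 2 * D)); last by ring.
  by apply: ler_wpM2l => //; lra.
have h2 := weighted_emp_excess z j0 l0 ln_.
have := dev j0 (ltn_ord j0); rewrite ler_norml => /andP[_].
have -> : ln M%:R / l%:R = 2 * (ln M%:R / (2 * l%:R)) :> R.
  by field; rewrite pnatr_eq0 -lt0n.
move: h1 h2; move: (\sum_(j < M) _) (\sum_(j < M) _) (emp_excess _ _ _ _ _)
  (excess _) (ln _ / _) => u v x y t; lra.
Qed.

End aggregation.

(** * Rates *)

Section sample_split.
Context {R : realType}.

Lemma ln_le_powR (t x : R) : 0 < t -> 0 < x -> ln x <= x `^ t / t.
Proof.
move=> t0 x0; rewrite ler_pdivlMr// mulrC -ln_powR ltW//.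
by apply: ln_sublinear; exact: powR_gt0.
Qed.

(** Beyond it [ln n] is at least [4 * a], so the second subsample has at most [n / 4 + 1] elements
    after rounding, and [n >= 4] turns this into [n / 2]. *)
Definition split_threshold (a : R) : R := 4 + expR (4 * a).

Lemma size_split (a : R) (n : nat) : 0 < a -> split_threshold a <= n%:R ->
  [/\ a * n%:R / ln n%:R <= (size_l a n)%:R, (0 < size_l a n)%N,
      (size_m a n < n)%N, (0 < size_m a n)%N & (n <= 2 * size_m a n)%N].
Proof.
rewrite /split_threshold => a0 na.
have n4 : 4 <= n%:R :> R by apply: le_trans na; rewrite lerDl expR_ge0.
have n0 : 0 < n%:R :> R by apply: lt_le_trans n4.
have lna : 4 * a <= ln (n%:R : R).
  rewrite -[leLHS]expRK ler_ln ?posrE ?expR_gt0//.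
  by apply: le_trans na; rewrite lerDr.
have ln0 : 0 < ln (n%:R : R) by apply: lt_le_trans lna; rewrite mulr_gt0.
set u := a * n%:R / ln n%:R.
have u0 : 0 < u by rewrite divr_gt0// mulr_gt0.
have u4 : u <= n%:R / 4.
  rewrite ler_pdivrMr// mulrAC ler_pdivlMr//.
  by rewrite mulrC mulrA [leRHS]mulrC ler_wpM2r.
have lE : (size_l a n)%:R = (Num.ceil u)%:~R :> R.
  rewrite /size_l -/u natr_absz ger0_norm//.
  by rewrite ltW// ceil_gt0.
have lu : u <= (size_l a n)%:R by rewrite lE ceil_ge.
have lu1 : (size_l a n)%:R < u + 1.
  by rewrite lE -ltrBlDr; have := ceilB1_lt u; rewrite intrB.
have l2 : (2 * size_l a n <= n)%N.
  rewrite -(ler_nat R) natrM.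
  by move: lu1 u4 n4; move: (size_l a n)%:R => v; lra.
have l0 : (0 < size_l a n)%N by rewrite -(ltr_nat R) (lt_le_trans u0).
split=> //; rewrite /size_m; move: l2 l0; move: (size_l a n) => v; lia.
Qed.

Lemma grid_choice (rmin rmax rho : R) (N : nat -> nat) (m : nat) :
  (0 < N m)%N -> rmin <= rho <= rmax ->
  exists2 j, (j <= N m)%N & rho <= rho_grid rmin rmax N m j <=
    rho + (rmax - rmin) / (N m)%:R.
Proof.
move=> N0 /andP[rl ru].
have N0R : 0 < (N m)%:R :> R by rewrite ltr0n.
have w0 : 0 <= (rmax - rmin) / (N m)%:R by rewrite divr_ge0//; lra.
have ex : exists j, (j <= N m)%N && (rho <= rho_grid rmin rmax N m j).
  exists (N m); rewrite leqnn /rho_grid divff ?gt_eqF//; lra.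
(* The least grid point above [rho] exceeds it by at most one step, because its predecessor lies
   below [rho]; index 0 gives [rmin] itself. *)
case: (ex_minnP ex) => j /andP[jN rj] minj; exists j => //; rewrite rj/=.
case: j jN rj minj => [|j] jN rj minj.
  by rewrite /rho_grid !mul0r; lra.
have : ~~ (rho <= rho_grid rmin rmax N m j).
  apply/negP => h; have := minj j; rewrite h ltnW// ltnn.
  by move=> /(_ isT).
rewrite -ltNge /rho_grid -natr1 => h.
rewrite (_ : (j%:R + 1) / (N m)%:R * (rmax - rmin) =
    j%:R / (N m)%:R * (rmax - rmin)
  + (rmax - rmin) / (N m)%:R); last by ring.
by rewrite addrA lerD2r ltW.
Qed.

(** A grid step is at most the inverse of [A0'] times [m] to the power [b'], while [ln n] is at most
    [n] to the power [b'] over [b']; with [n <= 2 * m] the powers of [m] cancel in their product. *)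
Definition grid_cst (A0' b' : R) : R := expR (2 `^ b' / (A0' * b')).

Lemma grid_step_cost (rmin rmax A0' b' t : R) (K n m : nat) :
  0 < rmin -> rmin < rmax -> rmax < 1 -> 0 < A0' -> 0 < b' -> (0 < m)%N ->
  (n <= 2 * m)%N -> A0' * m%:R `^ b' <= K%:R -> 0 <= t ->
  t <= (rmax - rmin) / K%:R -> n%:R `^ t <= grid_cst A0' b'.
Proof.
move=> rm rr rM a0 b0 m0 nm mK t0 tK.
have m0R : 0 < m%:R :> R by rewrite ltr0n.
have mb : 0 < m%:R `^ b' by exact: powR_gt0.
have K0 : 0 < K%:R :> R by apply: lt_le_trans mK; rewrite mulr_gt0.
have [->|n0] := posnP n.
  apply: (@le_trans _ _ 1); last first.
    by rewrite -expR0 ler_expR divr_ge0 ?powR_ge0// mulr_ge0 ?ltW.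
  (* By convention 0 to the power [t] is 1 for [t = 0] and 0 otherwise. *)
  by rewrite /powR eqxx; case: (t == 0).
have n0R : 0 < n%:R :> R by rewrite ltr0n.
rewrite powR_expR// ler_expR.
have lnn : ln (n%:R : R) <= 2 `^ b' * m%:R `^ b' / b'.
  apply: le_trans (ln_le_powR b0 n0R) _.
  apply: ler_wpM2r; first by rewrite invr_ge0 ltW.
  rewrite -powRM//; apply: ge0_ler_powR; rewrite ?nnegrE ?mulr_ge0 ?(ltW b0)//.
  by rewrite -natrM ler_nat.
have t1 : t <= (A0' * m%:R `^ b')^-1.
  apply: le_trans tK _; apply: (@le_trans _ _ K%:R^-1).
    by rewrite ler_piMl ?invr_ge0//; lra.
  by rewrite lef_pV2 ?posrE// mulr_gt0.
have lb0 : 0 <= 2 `^ b' * m%:R `^ b' / b'.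
  by rewrite divr_ge0 ?mulr_ge0 ?powR_ge0// ltW.
apply: (@le_trans _ _ (t * (2 `^ b' * m%:R `^ b' / b')));
    first by rewrite ler_wpM2l.
apply: le_trans (ler_wpM2r lb0 t1) _.
rewrite -subr_ge0 (_ : _ - _ = 0)//.
by field; rewrite !gt_eqF.
Qed.

(** For [kappa >= 1] the target exponent is at most [(1 + rho)^-1], and passing to [(1 + rho')^-1]
    changes it by at most [rho' - rho], which [C1] pays for. *)
Lemma net_radius_cost (kappa rho rho' C1 u abar : R) (n m : nat) :
  1 <= kappa -> 0 < rho -> rho < 1 -> rho <= rho' -> (0 < m)%N ->
  (n <= 2 * m)%N -> (0 < n)%N -> n%:R `^ (rho' - rho) <= C1 -> 0 < u <= abar ->
  u * m%:R `^ (- (1 + rho')^-1) <= 2 * abar * C1 * rate kappa rho n%:R.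
Proof.
move=> k1 r0 r1 rr m0 nm n0 nC /andP[u0 ua].
have n0R : 0 < n%:R :> R by rewrite ltr0n.
have n1R : 1 <= n%:R :> R by rewrite ler1n.
have m0R : 0 < m%:R :> R by rewrite ltr0n.
have r'0 : 0 < 1 + rho' by lra.
have r'1 : (1 + rho')^-1 <= 1 by rewrite invf_le1//; lra.
have C10 : 0 <= C1 by apply: le_trans nC; exact: powR_ge0.
have h1 : m%:R `^ (- (1 + rho')^-1) <= 2 * n%:R `^ (- (1 + rho')^-1).
  rewrite !powRN -[X in X * _]invrK -invfM lef_pV2 ?posrE ?mulr_gt0 ?invr_gt0
      ?powR_gt0//.
  rewrite ler_pdivrMl//.
  apply: (@le_trans _ _ ((2 * m%:R) `^ (1 + rho')^-1)).
    apply: ge0_ler_powR; rewrite ?nnegrE ?mulr_ge0 ?invr_ge0 ?(ltW r'0)//.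
    by rewrite -natrM ler_nat.
  rewrite powRM// ler_wpM2r ?powR_ge0//.
  by apply: ler1_powR => //; rewrite ler1n.
have h2 : n%:R `^ (- (1 + rho')^-1) <= C1 * rate kappa rho n%:R.
  apply: (@le_trans _ _ (n%:R `^ (rho' - rho) * rate kappa rho n%:R));
      last first.
    by rewrite ler_wpM2r// ltW// rate_gt0.
  rewrite /rate -powRD ?(gt_eqF n0R) ?implybT//.
  apply: ler_powR => //.
  have D0 : 0 < 2 * kappa + rho - 1 by lra.
  have e1 : kappa / (2 * kappa + rho - 1) <= (1 + rho)^-1.
    rewrite ler_pdivrMr// ler_pdivlMl//; last by lra.
    by nra.
  have e2 : (1 + rho)^-1 - (1 + rho')^-1 <= rho' - rho.
    have -> : (1 + rho)^-1 - (1 + rho')^-1 =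
        (rho' - rho) * ((1 + rho) * (1 + rho'))^-1.
      by field; rewrite !gt_eqF//; lra.
    rewrite ler_piMr ?subr_ge0// invf_le1; last by rewrite mulr_gt0//; lra.
    by nra.
  by move: e1 e2; move: (kappa / _) ((1 + rho)^-1) ((1 + rho')^-1) => p q s;
      lra.
apply: (@le_trans _ _ (abar * (2 * (C1 * rate kappa rho n%:R)))); last first.
  by rewrite -subr_ge0 (_ : _ - _ = 0)//; ring.
apply: ler_pM; rewrite ?powR_ge0 ?(ltW u0)//.
by apply: le_trans h1 _; rewrite ler_wpM2l.
Qed.

(** Bounds the logarithm of twice the number of candidates; the leading 1 supplies the [1 <= s] of
    [selection_deviation]. *)
Definition count_log (A0 b : R) (n : nat) : R :=
  1 + ln (2 * (A0 + 1)) + b * ln n%:R.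

(** [rmin / (2 * kappa)] is a lower bound, uniform in [rho], for [rho / (2 * kappa + rho - 1)]; [t]
    is the constant comparing [ln n] with [n] to half that power. *)
Definition count_cst (a b A0 rmin kappa : R) : R :=
  let t := 2 / (rmin / (2 * kappa)) in
  ((1 + ln (2 * (A0 + 1))) * t + b * t ^+ 2) / a.

Lemma count_logP (A0 b : R) (K n m : nat) : 0 < A0 -> 0 < b -> (0 < n)%N ->
  (m <= n)%N -> K%:R <= A0 * m%:R `^ b ->
  1 <= count_log A0 b n /\ 2 * K.+1%:R <= expR (count_log A0 b n).
Proof.
move=> A00 b0 n0 mn KA.
have n1R : 1 <= n%:R :> R by rewrite ler1n.
have n0R : 0 < n%:R :> R by rewrite ltr0n.
have A1 : 0 < 2 * (A0 + 1) by lra.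
have lA : 0 <= ln (2 * (A0 + 1)) by apply: ln_ge0; lra.
have lnn : 0 <= b * ln n%:R by rewrite mulr_ge0 ?ln_ge0// ltW.
split; first by rewrite /count_log -addrA lerDl addr_ge0.
have nb : 1 <= n%:R `^ b.
  by rewrite -[leLHS](powRr0 n%:R) ler_powR// ltW.
have KA' : K%:R <= A0 * n%:R `^ b.
  apply: le_trans KA _; apply: ler_wpM2l; first exact: ltW.
  by apply: ge0_ler_powR; rewrite ?nnegrE ?ler_nat ?(ltW b0).
rewrite /count_log -addrA expRD expRD lnK ?posrE// -powR_expR//.
apply: (@le_trans _ _ (2 * (A0 + 1) * n%:R `^ b)).
  rewrite -mulrA ler_wpM2l// -natr1 mulrDl mul1r.
  exact: lerD.
apply: ler_peMl; first by apply: mulr_ge0; [exact: ltW|exact: powR_ge0].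
by rewrite -expR0 ler_expR.
Qed.

(** Since [l] is at least [a * n / ln n], the right-hand side is of order [n] to the power
    [rho / (2 * kappa + rho - 1)] divided by [ln n], a positive power of [n] that beats the squared
    logarithm. *)
Lemma count_cost (a b A0 rmin kappa rho : R) (l n : nat) :
  0 < a -> 0 < b -> 0 < A0 -> 0 < rmin -> rmin <= rho -> rho < 1 -> 1 <=
      kappa ->
  1 < n%:R :> R -> a * n%:R / ln n%:R <= l%:R ->
  count_log A0 b n <=
  count_cst a b A0 rmin kappa * l%:R * scale0 kappa rho n%:R `^ (2 * kappa - 1).
Proof.
move=> a0 b0 A00 rm rr r1 k1 n1 al.
have n0R : 0 < n%:R :> R by apply: lt_trans n1.
have ln0 : 0 < ln (n%:R : R) by apply: ln_gt0.
have D0 : 0 < 2 * kappa + rho - 1 by lra.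
set s0 := 1 + ln (2 * (A0 + 1)).
have s00 : 0 <= s0 by rewrite addr_ge0// ln_ge0//; lra.
set th := rmin / (2 * kappa); have th0 : 0 < th by rewrite divr_gt0//; lra.
have h2 : 0 < th / 2 by rewrite divr_gt0.
set t := 2 / th; have t0 : 0 < t by rewrite divr_gt0.
set x := n%:R `^ (th / 2).
have x1 : 1 <= x by rewrite -[leLHS](powRr0 n%:R) ler_powR ?ltW.
have lx : ln (n%:R : R) <= t * x.
  by have := ln_le_powR h2 n0R; rewrite invf_div -/x mulrC.
have xx : x ^+ 2 = n%:R `^ th.
  by rewrite -powR_mulrn ?powR_ge0// -powRrM divfK.
have sc : scale0 kappa rho n%:R `^ (2 * kappa - 1) * n%:R =
    n%:R `^ (rho / (2 * kappa + rho - 1)).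
  rewrite /scale0 -powRrM -[X in _ * X = _](powRr1 (ltW n0R)) -powRD
      ?(gt_eqF n0R) ?implybT//.
  by congr (_ `^ _); field; rewrite gt_eqF.
have thD : n%:R `^ th <= n%:R `^ (rho / (2 * kappa + rho - 1)).
  apply: ler_powR; first exact: ltW.
  rewrite /th ler_pdivlMr// mulrAC ler_pdivrMr; last by lra.
  by nra.
have key : count_log A0 b n * ln n%:R <= (s0 * t + b * t ^+ 2) * x ^+ 2.
  rewrite /count_log -/s0 mulrDl [leRHS]mulrDl; apply: lerD.
    rewrite -mulrA ler_wpM2l//; apply: le_trans lx _.
    by rewrite ler_wpM2l ?(ltW t0)// expr2 ler_peMl//; lra.
  have -> : b * t ^+ 2 * x ^+ 2 = b * ((t * x) * (t * x)) by ring.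
  rewrite -[leLHS]mulrA; apply: ler_wpM2l; first exact: ltW.
  by apply: ler_pM => //; exact: ltW.
have C0 : 0 <= s0 * t + b * t ^+ 2.
  by rewrite addr_ge0// mulr_ge0 ?exprn_ge0// ltW.
have sp : 0 <= scale0 kappa rho n%:R `^ (2 * kappa - 1) by exact: powR_ge0.
rewrite /count_cst -/s0 -/th -/t.
rewrite -(ler_pM2r ln0); apply: le_trans key _.
rewrite xx; apply: le_trans (ler_wpM2l C0 thD) _; rewrite -sc.
have al' : n%:R <= l%:R * ln n%:R / a.
  by rewrite ler_pdivlMr// mulrC -ler_pdivrMr.
have -> : (s0 * t + b * t ^+ 2) / a * l%:R *
    scale0 kappa rho n%:R `^ (2 * kappa - 1) * ln n%:R =
  (s0 * t + b * t ^+ 2) * (scale0 kappa rho n%:R `^ (2 * kappa - 1) *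
     (l%:R * ln n%:R / a)) by field; rewrite gt_eqF.
by apply: ler_wpM2l => //; exact: ler_wpM2l.
Qed.

End sample_split.

(** * The convergence rate of the aggregate *)

Section convergence_rate.
Context {R : realType}.
Variables (a b b' A A0 A0' rmin rmax abar kappa c : R).
Hypothesis a_gt0 : 0 < a.
Hypothesis b'_gt0 : 0 < b'.
Hypothesis b'b : b' <= b.
Hypothesis A_gt0 : 0 < A.
Hypothesis A0_gt0 : 0 < A0.
Hypothesis A0'_gt0 : 0 < A0'.
Hypothesis rmin_gt0 : 0 < rmin.
Hypothesis rmin_rmax : rmin < rmax.
Hypothesis rmax_lt1 : rmax < 1.
Hypothesis k1 : 1 <= kappa.
Hypothesis c_gt0 : 0 < c.

(** The value given to [tau], small enough for the margin term to take at most half of the excess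
    risk. *)
Definition slack : R := (1 + 4 * (c / 2) `^ kappa)^-1.
Definition erm_cst : R := 3 * (2 * abar * grid_cst A0' b') + 8 * slack
  + 4 * deviation_cst A (grid_cst A0' b') rmax slack.
Definition aggregate_cst : R := 6 * erm_cst
  + (16 * slack + 16 * (count_cst a b A0 rmin kappa / slack))
  + 2 * count_cst a b A0 rmin kappa.

Lemma slack_bounds : 0 < slack <= 1 /\ 2 * slack * (c / 2) `^ kappa <= 2^-1.
Proof.
have q0 : 0 <= (c / 2) `^ kappa := powR_ge0 _ _.
have s0 : 0 < 1 + 4 * (c / 2) `^ kappa by lra.
rewrite /slack invr_gt0 s0 invf_le1//; split; first by lra.
by rewrite mulrAC ler_pdivrMr//; lra.
Qed.

Context {d : nat} (calG : R -> set (set (Rspace R d))) (rho : R)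
  (pi : probability (obs R d) R) (eta : Rspace R d -> R) (N : nat -> nat)
  (a_ : nat -> nat -> R)
  (net : forall n, nat -> n.-tuple (obs R d) -> set (set (Rspace R d)))
  (Ghat : forall n, nat -> n.-tuple (obs R d) -> set (Rspace R d)).
Hypothesis rho_bounds : rmin <= rho <= rmax.
Hypothesis pi_class : margin_class kappa c (calG rho) pi eta.
Hypothesis A1 : assumption_A1 (marginal pi) A A0 A0' b b' rmin rmax abar
  calG N a_ net.
Hypothesis erm : emp_risk_minimizers N net Ghat.
Context (n : nat) dO (Omega : measurableType dO) (P : probability Omega R)
  (Z : nat -> {RV P >-> obs R d}).
Hypothesis iidZ : iid_sample pi Z n.

Lemma measurable_rule k j D : measurable (@Ghat k j D).
Proof.
have -> : @Ghat k j D = (fun x => (D, x)) @^-1`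
    [set p : k.-tuple (obs R d) * Rspace R d | Ghat j p.1 p.2] by [].
have [mG _] := erm; have mS := mG k j.
by rewrite -[X in measurable X]setTI; exact: measurable_pair1.
Qed.

Lemma aggregate_rate : split_threshold a <= n%:R ->
  exists Y, mean_le P Y (rate kappa rho n%:R * aggregate_cst) /\
  forall w, excess_risk pi eta (aggregate a N Ghat n (Z ^~ w)) <= Y w.
Proof.
move=> na; have /andP[rl ru] := rho_bounds.
have := (rmin_gt0, rmin_rmax, rmax_lt1) => -[[rm0 rmm] rM1].
have := (b'_gt0, b'b) => -[b'0 bb'].
have [reg mrg GG0] := pi_class.
have [lal l0 mn m0 nm] := size_split a_gt0 na.
set m := size_m a n in mn m0 nm *; set l := size_l a n in lal l0.
have n4 : 4 <= n%:R :> R by apply: le_trans na; rewrite lerDl expR_ge0.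
have n0 : (0 < n)%N by exact: leq_ltn_trans mn.
have ln_ : (l <= n)%N.
  by rewrite leqNgt; apply/negP => h; move: m0;
      rewrite /m /size_m -/l subn_gt0 ltnNge ltnW.
have nml : (n - m)%N = l by rewrite /m /size_m -/l subKn.
have r0 : 0 < rho by lra.
have r1 : rho < 1 by lra.
have [t01 tm] := slack_bounds; have /andP[t0 t1] := t01.
have b0 : 0 < b by lra.
have /andP[NA' NA] := A1_grid A1 m0.
have m0R : 0 < m%:R :> R by rewrite ltr0n.
have Nm0 : (0 < N m)%N.
  by rewrite -(ltr_nat R); apply: lt_le_trans NA'; rewrite mulr_gt0// powR_gt0.
(* The oracle candidate: its class still contains the Bayes set by nestedness, and its parameter
   exceeds [rho] by at most one grid step. *)
have [j0 j0N /andP[rj0 rj1]] := grid_choice Nm0 rho_bounds.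
set rho' := rho_grid rmin rmax N m j0 in rj0 rj1.
have nC1 : n%:R `^ (rho' - rho) <= grid_cst A0' b'.
  apply: (grid_step_cost rmin_gt0 rmin_rmax rmax_lt1 A0'_gt0 b'_gt0 m0 nm NA').
    by rewrite subr_ge0.
  by rewrite lerBlDl.
have r'M : rho' <= rmax.
  rewrite /rho' /rho_grid.
  have : j0%:R / (N m)%:R <= 1 :> R by rewrite ler_pdivrMr
      ?ltr0n// mul1r ler_nat.
  by move: (_ / _) => q q1; nra.
have GG' : calG rho' (bayes_set eta).
  move: rj0; rewrite le_eqVlt => /predU1P[<-//|rlt].
  exact: (A1_nested A1 rl rlt r'M).
have epsE := net_radius_cost k1 r0 r1 rj0 m0 nm n0 nC1 (A1_radius A1 m0 j0N).
have [erm_meas erm_min] := erm.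
have [W [W1 WE]] := erm_excess reg k1 c_gt0 mrg r0 t01 tm n0 iidZ ru rmax_lt1
  rj0 A_gt0 m0 (ltnW mn) nm nC1 epsE GG' (A1_net_complexity A1 m0 j0N)
  (fun D G => A1_net_measurable A1 m0 j0N) (A1_net A1 m0 j0N)
  (fun D => erm_min m j0 D m0 j0N).
have [s1 sM] := count_logP A0_gt0 b0 n0 (ltnW mn) NA.
have n1 : 1 < n%:R :> R by apply: lt_le_trans n4; rewrite ltr1n.
have sC2 := count_cost a_gt0 b0 A0_gt0 rmin_gt0 rl r1 k1 n1 lal.
set C2 := count_cst a b A0 rmin kappa in sC2;
    set s := count_log A0 b n in s1 sM sC2.
have sC2' := sC2; rewrite -nml in sC2'.
have [Y [Y1 YE]] := selection_deviation reg k1 c_gt0 mrg r0 t01 tm n0 iidZ mn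
  (erm_meas m) sM s1 sC2'.
have x1 : 1 <= n%:R :> R by rewrite ler1n.
pose e := rate kappa rho n%:R; have e0 : 0 < e by exact: rate_gt0.
have p0 : 0 < scale0 kappa rho n%:R `^ (2 * kappa - 1).
  by apply: powR_gt0; exact: scale0_gt0.
have l0R : 0 < l%:R :> R by rewrite ltr0n.
(* A negative constant would contradict [1 <= s] together with [sC2]. *)
have C20 : 0 <= C2.
  rewrite leNgt; apply/negP => C2n; have := le_trans s1 sC2; apply/negP.
  rewrite -ltNge; apply: lt_trans ltr01.
  by rewrite pmulr_llt0// pmulr_llt0.
have C2s0 : 0 <= C2 / slack by rewrite divr_ge0// ltW.
have lnM : ln (N m).+1%:R / l%:R <= C2 * e.
  rewrite ler_pdivrMr//; apply: (@le_trans _ _ s).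
    rewrite -[leRHS]expRK ler_ln ?posrE ?expR_gt0//; apply: le_trans sM.
    by rewrite ler_peMl// ler1n.
  apply: le_trans sC2 _; rewrite mulrAC ler_wpM2r// ler_wpM2l//.
  rewrite /e rateE; apply: ger_powR; last by move: k1; lra.
  by rewrite scale0_gt0//= scale0_le1.
have g0 : 0 <= 2 * abar * grid_cst A0' b'.
  rewrite mulr_ge0 ?expR_ge0// mulr_ge0//.
  by have /andP[/ltW a1 a2] := A1_radius A1 m0 j0N; exact: le_trans a2.
(* The bound of [aggregate_excess] for [j0], with [W] from the minimization and [Y] from the
   selection. As [Y] has mean at most 1, the 8 before [C2 / slack] becomes 16 in [aggregate_cst]. *)
exists (fun w => e * (6 * (3 * (2 * abar * grid_cst A0' b') + 8 * slack)
    + (16 * slack + 8 * (C2 / slack)) + 2 * C2)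
  + (e * 24 * W w + e * (8 * (C2 / slack)) * Y w)).
split.
  apply: (@mean_leS _ _ _ _ _ (e *
      (6 * (3 * (2 * abar * grid_cst A0' b') + 8 * slack)
    + (16 * slack + 8 * (C2 / slack)) + 2 * C2) +
    (e * 24 * deviation_cst A (grid_cst A0' b') rmax slack
     + e * (8 * (C2 / slack)) * 1))); last first.
    rewrite -subr_ge0 (_ : _ - _ = 0)// /aggregate_cst /erm_cst -/C2 -/e.
    move: (deviation_cst _ _ _ _) (C2 / slack) => u v; ring.
  apply: mean_leD; [apply: mean_le_cst|apply: mean_leD; apply: mean_leZ => //].
  - apply: mulr_ge0; first exact: ltW.
    by apply: addr_ge0; [apply: addr_ge0|]; lra.
  - by rewrite mulr_ge0// ltW.
  - by rewrite mulr_ge0 ?(ltW e0)// mulr_ge0.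
move=> w; have W0 : 0 <= W w by case: W1.
have := aggregate_excess reg (a := a) measurable_rule
    (Ordinal (n:=(N m).+1) j0N) l0 ln_ (YE w).
move/le_trans; apply.
have := WE w; rewrite -/e /=.
move: lnM; rewrite -/m -/l; move: (ln _ / _) (set_excess _ _ _) => u v hu hv.
have -> : e * (6 * (3 * (2 * abar * grid_cst A0' b') + 8 * slack)
    + (16 * slack + 8 * (C2 / slack)) + 2 * C2)
  + (e * 24 * W w + e * (8 * (C2 / slack)) * Y w) =
  6 * (e * (3 * (2 * abar * grid_cst A0' b') + 8 * slack + 4 * W w)) +
  8 * (e * (2 * slack + C2 / slack * (1 + Y w))) + 2 * (C2 * e).
  by move: (C2 / slack) => x; ring.
move: hv hu; move: (e * _) (e * _) (C2 * e) => x y t hv hu; lra.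
Qed.

Lemma aggregate_risk_bound : (0 < n)%N ->
  ('E_P[fun w => excess_risk pi eta (aggregate a N Ghat n (Z ^~ w))]
    <= ((`|aggregate_cst| + split_threshold a) * rate kappa rho n%:R)%:E)%E.
Proof.
move=> n0; have [reg _ _] := pi_class.
have x1 : 1 <= n%:R :> R by rewrite ler1n.
have n0R : 0 < n%:R :> R by rewrite ltr0n.
have e0 : 0 < rate kappa rho n%:R by exact: rate_gt0.
have ge0 w : 0 <= excess_risk pi eta (aggregate a N Ghat n (Z ^~ w)).
  apply: aggregate_excess_ge0 => //; exact: measurable_rule.
have thr0 : 0 <= split_threshold a by rewrite addr_ge0// expR_ge0.
have [na|/ltW na] := leP (split_threshold a) n%:R.
  have [Y [Y1 YE]] := aggregate_rate na.
  apply: expectation_le_mean ge0 YE; apply: mean_leS Y1 _.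
  by rewrite mulrC ler_wpM2r ?(ltW e0)// (le_trans (ler_norm _))// lerDl.
(* Below the threshold the split may degenerate, but the excess is at most 1, and so is 1 at most
   [n] times the rate, whose exponent does not exceed 1. *)
apply: (@expectation_le_mean _ _ _ _ _ (cst 1)) ge0 _; last first.
  by move=> w; apply: aggregate_excess_le1 => //; exact: measurable_rule.
apply: (@mean_leS _ _ _ _ _ 1); first exact: mean_le_cst.
apply: (@le_trans _ _ (n%:R * rate kappa rho n%:R)); last first.
  by rewrite ler_wpM2r ?(ltW e0)// (le_trans na)// lerDr.
rewrite /rate powRN ler_pdivlMr ?powR_gt0// mul1r.
apply: ler1_powR => //; have /andP[rl _] := rho_bounds.
have := (rmin_gt0, k1) => -[rm0 k1'].
by rewrite ler_pdivrMr; lra.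
Qed.

End convergence_rate.

Theorem theorem3p1 (R : realType)
    (a b b' A A0 A0' rmin rmax abar kappa c : R) :
  0 < a -> 0 < b' -> b' <= b -> 0 < A -> 0 < A0 -> 0 < A0' -> 0 < abar ->
  0 < rmin -> rmin < rmax -> rmax < 1 -> 1 <= kappa -> 0 < c ->
  exists C : R, 0 < C /\
    forall (d : nat) (calG : R -> set (set (Rspace R d)))
      (rho : R) (pi : probability (obs R d) R) (eta : Rspace R d -> R)
      (N : nat -> nat) (a_ : nat -> nat -> R)
      (net : forall n, nat -> n.-tuple (obs R d) -> set (set (Rspace R d)))
      (Ghat : forall n, nat -> n.-tuple (obs R d) -> set (Rspace R d)),
    rmin <= rho <= rmax ->
    margin_class kappa c (calG rho) pi eta ->
    assumption_A1 (marginal pi) A A0 A0' b b' rmin rmax abar calG N a_ net ->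
    emp_risk_minimizers N net Ghat ->
    forall (n : nat) (dO : measure_display) (Omega : measurableType dO)
      (P : probability Omega R) (Z : nat -> {RV P >-> obs R d}),
    (1 <= n)%N -> iid_sample pi Z n ->
    ('E_P[fun w => excess_risk pi eta
                     (aggregate a N Ghat n (fun i => Z i w))]
       <= (C * n%:R `^ (- (kappa / (2 * kappa + rho - 1))))%:E)%E.
Proof.
move=> a0 b'0 b'b A_0 A00 A0'0 abar0 rm0 rmm rM1 k1 c0.
(* The absolute value gives positivity at once, and the threshold covers the small sample sizes. *)
exists (`|aggregate_cst a b b' A A0 A0' rmin rmax abar kappa c|
  + split_threshold a); split.
  by rewrite ltr_wpDl// addr_gt0// expR_gt0.
move=> d calG rho pi eta N a_ net Ghat rho_b pi_class A1 erm n dO Omega P Z n1 iidZ.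
exact: (aggregate_risk_bound a0 b'0 b'b A_0 A00 A0'0 rm0 rmm rM1 k1 c0 rho_b
  pi_class A1 erm iidZ n1).
Qed.
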